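(* Let $M$ be a compact, connected, oriented Riemannian manifold and let $P:\mathscr{D}'(M)\to\mathscr{D}'(M)$ be a continuous linear operator that maps $\mathscr{C}^\infty(M)$ into itself. If $P$ is almost globally hypoelliptic (AGH) in $M$, then $P:\mathscr{C}^\infty(M)\to\mathscr{C}^\infty(M)$ has closed range. In particular, if $P$ is globally hypoelliptic (GH) in $M$, then it is globally solvable in $\mathscr{C}^\infty$.
   Context: $\mathscr{D}'(M)$ is the space of distributions on $M$, i.e. the topological dual of $\mathscr{C}^\infty(M)$ (with its usual Fréchet topology), endowed with the strong dual topology; functions are identified with distributions through the Riemannian volume form. ${}^{\mathrm t}P:\mathscr{D}'(M)\to\mathscr{D}'(M)$ denotes the transpose of $P:\mathscr{C}^\infty(M)\to\mathscr{C}^\infty(M)$. $P$ is globally hypoelliptic (GH) in $M$ if for every $u\in\mathscr{D}'(M)$, $Pu\in\mathscr{C}^\infty(M)$ implies $u\in\mathscr{C}^\infty(M)$. $P$ is almost globally hypoelliptic (AGH) in $M$ if for every $u\in\mathscr{D}'(M)$ with $Pu\in\mathscr{C}^\infty(M)$ there exists $v\in\mathscr{C}^\infty(M)$ such that $Pv=Pu$. $P$ is globally solvable in $\mathscr{C}^\infty$ if for every $f\in\mathscr{C}^\infty(M)$ satisfying $\langle v,f\rangle=0$ for every $v\in\mathscr{D}'(M)$ with ${}^{\mathrm t}Pv=0$, there exists $u\in\mathscr{C}^\infty(M)$ such that $Pu=f$. *)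

(* Defs.v *)
From HB Require Import structures.
From mathcomp Require Import all_boot all_order all_algebra.
From mathcomp Require Import all_classical all_reals all_analysis.
From mathcomp Require Import complex.

Set Implicit Arguments.
Unset Strict Implicit.
Unset Printing Implicit Defensive.

Import Order.TTheory GRing.Theory Num.Theory.
Import numFieldNormedType.Exports.

Local Open Scope classical_set_scope.
Local Open Scope ring_scope.
Local Open Scope complex_scope.

Import ComplexField.Normc.

(* mathcomp-real-closed puts no topology on R[i]; the one used here is the norm
   topology that every numFieldType carries. *)
HB.instance Definition _ (R : realType) :=
  NormedModule.copy R[i] ((R[i] : numClosedFieldType)^o).

(* Lebesgue measure on R^n, as the n-fold product of the one on R; the library
   has a sigma-algebra on n.-tuple T but none on 'rV[R]_n. *)
Section cons_measure.
Context {R : realType} {n : nat}.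
Local Notation T := (measurableTypeR R).
Variable mu : {sigma_finite_measure set (n.-tuple T) -> \bar R}.

Definition tcons (p : T * n.-tuple T) : n.+1.-tuple T :=
  [the n.+1.-tuple T of p.1 :: p.2].

Lemma measurable_tcons : measurable_fun [set: T * n.-tuple T] tcons.
Proof. exact: measurable_cons. Qed.

Definition cons_measure : set (n.+1.-tuple T) -> \bar R :=
  pushforward (lebesgue_measure \x mu)%E tcons.

Let cons_measure0 : cons_measure set0 = 0%E.
Proof. by rewrite /cons_measure /pushforward preimage_set0 measure0. Qed.

Let cons_measure_ge0 A : (0 <= cons_measure A)%E.
Proof. by rewrite /cons_measure /pushforward; apply: measure_ge0. Qed.

Let cons_measure_sigma_additive : semi_sigma_additive cons_measure.
Proof.
move=> F mF tF mUF; rewrite /cons_measure /pushforward preimage_bigcup.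
apply: measure_semi_sigma_additive.
- by move=> k; rewrite -[X in measurable X]setTI; exact: measurable_tcons.
- apply/trivIsetP => /= i j _ _ ij; rewrite -preimage_setI.
  by move/trivIsetP : tF => /(_ _ _ _ _ ij) ->//; rewrite preimage_set0.
- rewrite -preimage_bigcup -[X in measurable X]setTI.
  exact: measurable_tcons.
Qed.

HB.instance Definition _ := isMeasure.Build _ _ _ cons_measure
  cons_measure0 cons_measure_ge0 cons_measure_sigma_additive.

Let cons_measure_sigma_finite : sigma_finite setT cons_measure.
Proof.
have /sigma_finiteP[F [FT ndF Foo]] :=
  sigma_finiteT (@lebesgue_measure R : {sigma_finite_measure set T -> \bar R}).
have /sigma_finiteP[G [GT ndG Goo]] := sigma_finiteT mu.
pose h (t : n.+1.-tuple T) : T * n.-tuple T := (thead t, [tuple of behead t]).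
have mh : measurable_fun setT h.
  apply/measurable_fun_pairP; split; first exact: measurable_tnth.
  exact: measurable_behead.
have hK p : h (tcons p) = p.
  by case: p => x t; rewrite /h /tcons /=; congr pair; apply/val_inj.
exists (fun k => h @^-1` (F k `*` G k)).
  rewrite -preimage_bigcup; apply/esym/seteqP; split => // t _ /=.
  have [i _ Fi] : (\bigcup_i F i) (h t).1 by rewrite -FT.
  have [j _ Gj] : (\bigcup_i G i) (h t).2 by rewrite -GT.
  exists (maxn i j) => //; split.
  - by move: Fi; exact/subsetPset/ndF/leq_maxl.
  - by move: Gj; exact/subsetPset/ndG/leq_maxr.
move=> k; have [mF Fk] := Foo k; have [mG Gk] := Goo k; split.
  by rewrite -[X in measurable X]setTI; apply: mh => //; exact: measurableX.
rewrite /cons_measure /pushforward -comp_preimage.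
rewrite (_ : h \o tcons = id) ?preimage_id; last exact/funext.
by rewrite product_measure1E// lte_mul_pinfty// ge0_fin_numE.
Qed.

HB.instance Definition _ := Measure_isSigmaFinite.Build _ _ _ cons_measure
  cons_measure_sigma_finite.

End cons_measure.

Fixpoint lebesgue_tuple {R : realType} (n : nat) :
    {sigma_finite_measure set (n.-tuple (measurableTypeR R)) -> \bar R} :=
  if n is m.+1 then cons_measure (lebesgue_tuple m) else \d_[tuple].

Section smooth_on.
Context {R : realType} {n : nat}.
Implicit Types (U : set 'rV[R]_n) (f g : 'rV[R]_n -> R) (s : seq 'I_n).

Fixpoint partial s f : 'rV[R]_n -> R :=
  if s is j :: s' then 'D_('e_j) (partial s' f) else f.

Definition smooth_on U f := forall s y, U y ->
  {for y, continuous (partial s f)} /\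
  forall j, derivable (partial s f) y 'e_j.

Lemma partial_linear U f g (a : R) s : open U -> smooth_on U f ->
  smooth_on U g -> forall y, U y ->
  partial s (fun z => a * f z + g z) y = a * partial s f y + partial s g y.
Proof.
move=> oU sf sg; elim: s => [//|j s IH] y Uy /=.
rewrite (@near_eq_derive _ _ _ _ (a \*: partial s f + partial s g)).
  have [_ df] := sf s y Uy; have [_ dg] := sg s y Uy.
  rewrite deriveD //; last exact: derivableZ.
  by rewrite deriveZ.
by near=> z; apply: IH; near: z; exact: open_nbhs_nbhs.
Unshelve. all: by end_near. Qed.

Lemma smooth_on_linear U f g (a : R) : open U -> smooth_on U f ->
  smooth_on U g -> smooth_on U (fun z => a * f z + g z).
Proof.
move=> oU sf sg s y Uy.
have nE : {near y, (a \*: partial s f + partial s g : _ -> _) =1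
                   partial s (fun z => a * f z + g z)}.
  near=> z; rewrite (partial_linear a s oU sf sg)//.
  by near: z; exact: open_nbhs_nbhs.
have [cf df] := sf s y Uy; have [cg dg] := sg s y Uy; split=> [|j].
  rewrite /prop_for /continuous_at -(nbhs_singleton nE).
  apply: cvg_trans (near_eq_cvg nE) _.
  by apply: cvgD => //; apply: cvgZr.
by apply: near_eq_derivable nE _; apply: derivableD => //; exact: derivableZ.
Unshelve. all: by end_near. Qed.

Lemma smooth_on_cst U (c : R) : smooth_on U (fun=> c).
Proof.
have pE s : exists d : R, partial s (fun=> c) = fun=> d.
  elim: s => [|j s [d IH]] /=; first by exists c.
  by exists 0; rewrite IH; apply/funext => y; rewrite derive_cst.
move=> s y _; have [d ->] := pE s; split=> [|j].
  exact: (@cst_continuous 'rV[R]_n R d y).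
exact: derivable_cst.
Qed.

End smooth_on.

Record chart (R : realType) (n : nat) (M : topologicalType) := Chart {
  dom : set M;
  coord : M -> 'rV[R]_n;
  param : 'rV[R]_n -> M;
  open_dom : open dom;
  open_coord : open (coord @` dom);
  coordK : forall x, dom x -> param (coord x) = x;
  continuous_coord : {within dom, continuous coord};
  continuous_param : {within coord @` dom, continuous param} }.

(* The orientation is carried by the atlas, all of whose coordinate changes have
   positive Jacobian determinant. *)
Record oriented_manifold (R : realType) (n : nat) := OrientedManifold {
  carrier :> ptopologicalType;
  hausdorff_carrier : hausdorff_space carrier;
  second_countable_carrier : @second_countable carrier;
  chart_index : Type;
  atlas : chart_index -> chart R n carrier;
  atlas_cover : forall x, exists i, dom (atlas i) x;
  atlas_smooth : forall i j k,
    smooth_on (coord (atlas i) @` (dom (atlas i) `&` dom (atlas j)))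
      (fun y => coord (atlas j) (param (atlas i) y) 0 k);
  atlas_oriented : forall i j x, dom (atlas i) x -> dom (atlas j) x ->
    0 < \det ('J (coord (atlas j) \o param (atlas i)) (coord (atlas i) x)) }.

Definition image_coord {R n} {M : oriented_manifold R n} (i : chart_index M) :=
  coord (atlas i) @` dom (atlas i).

(* [gram i y] is the matrix of the metric in the i-th coordinates at the point
   of coordinates y. Since 'J acts on row vectors from the right, the metric
   tensor transforms as J *m g *m J^T. *)
Record riemannian_metric {R n} (M : oriented_manifold R n) := RiemannianMetric {
  gram : chart_index M -> 'rV[R]_n -> 'M[R]_n;
  gram_smooth : forall i a b, smooth_on (image_coord i) (fun y => gram i y a b);
  gram_sym : forall i y, image_coord i y -> (gram i y)^T = gram i y;
  gram_posdef : forall i y (v : 'rV[R]_n), image_coord i y -> v != 0 ->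
    0 < (v *m gram i y *m v^T) 0 0;
  gram_change : forall i j x, dom (atlas i) x -> dom (atlas j) x ->
    let J := 'J (coord (atlas j) \o param (atlas i)) (coord (atlas i) x) in
    gram i (coord (atlas i) x) = J *m gram j (coord (atlas j) x) *m J^T }.

Definition borel (M : ptopologicalType) := g_sigma_algebraType (@open M).

(* The measure of the volume form, which is sqrt (det g) dy_1 ... dy_n in every
   positively oriented chart; these local expressions determine it. *)
Definition is_riemannian_volume {R n} {M : oriented_manifold R n}
    (g : riemannian_metric M) (vol : {measure set (borel M) -> \bar R}) :=
  forall i (A : set (borel M)), measurable A -> A `<=` dom (atlas i) ->
  vol A = (\int[lebesgue_tuple n]_(t in
             [set t | (coord (atlas i) @` A) (\row_j tnth t j)])
             (Num.sqrt (\det (gram g i (\row_j tnth t j))))%:E)%E.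

(* The seminorms p i, i in D, are \bar R-valued because they are defined below as
   suprema (which are -oo, hence harmless, over an empty set). *)
Section seminorms.
Context {R : realType} {V : zmodType} {I : Type}.
Variables (D : set I) (p : I -> V -> \bar R).

Definition nbhs_seminorms (x : V) : set_system V :=
  [set A | exists (F : set I) (e : R), [/\ finite_set F, F `<=` D, 0 < e &
    [set y | forall i, F i -> (p i (y - x)%R < e%:E)%E] `<=` A]].

Hypothesis p0 : forall i, D i -> (p i 0%R <= 0)%E.
Hypothesis pD : forall i x y, D i -> (p i (x + y)%R <= p i x + p i y)%E.

Lemma nbhs_seminorms_singleton x A : nbhs_seminorms x A -> A x.
Proof.
move=> [F [e [_ FD e0]]]; apply => i Fi; rewrite subrr.
by apply: le_lt_trans (p0 (FD _ Fi)) _; rewrite lte_fin.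
Qed.

Lemma nbhs_seminorms_filter x : ProperFilter (nbhs_seminorms x).
Proof.
apply: Build_ProperFilter_ex.
  by move=> A /nbhs_seminorms_singleton Ax; exists x.
split.
- by exists set0, 1; split.
- move=> A B [F [e [finF FD e0 FA]]] [G [d [finG GD d0 GB]]].
  exists (F `|` G), (Num.min e d); split.
  + by rewrite finite_setU.
  + by move=> i [/FD|/GD].
  + by rewrite lt_min e0.
  + move=> y Hy; split.
    * apply: FA => i Fi; apply: lt_le_trans (Hy i (or_introl Fi)) _.
      by rewrite lee_fin ge_min lexx.
    * apply: GB => i Gi; apply: lt_le_trans (Hy i (or_intror Gi)) _.
      by rewrite lee_fin ge_min lexx orbT.
- move=> A B AB [F [e [finF FD e0 FA]]]; exists F, e; split => //.
  exact: subset_trans FA AB.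
Qed.

Lemma nbhs_seminorms_nbhs x A :
  nbhs_seminorms x A -> nbhs_seminorms x (nbhs_seminorms^~ A).
Proof.
move=> [F [e [finF FD e0 FA]]]; exists F, (e / 2); split => //.
  by rewrite divr_gt0.
move=> y Hy; exists F, (e / 2); split => //; first by rewrite divr_gt0.
move=> z Hz; apply: FA => i Fi.
rewrite -(subrK y z) -addrA.
apply: le_lt_trans (pD _ _ (FD _ Fi)) _.
by rewrite [e]splitr EFinD; apply: lteD; [exact: Hz|exact: Hy].
Qed.

End seminorms.

(* von Neumann boundedness *)
Definition absorbed_bounded {R : realType} {V : NbhsLmodule.type R[i]}
    (B : set V) :=
  forall U, nbhs (0 : V) U -> exists2 r : R, 0 < r &
  forall x, B x -> exists2 y, U y & x = r%:C *: y.

Lemma Re_scaleD (R : rcfType) (a z w : R[i]) :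
  complex.Re (a * z + w) = complex.Re a * complex.Re z +
    (- complex.Im a * complex.Im z + complex.Re w).
Proof. by case: a z w => [? ?] [? ?] [? ?] /=; rewrite mulNr addrA. Qed.

Lemma Im_scaleD (R : rcfType) (a z w : R[i]) :
  complex.Im (a * z + w) = complex.Re a * complex.Im z +
    (complex.Im a * complex.Re z + complex.Im w).
Proof. by case: a z w => [? ?] [? ?] [? ?] /=; rewrite addrA. Qed.

Section smooth_functions.
Context {R : realType} {n : nat} (M : oriented_manifold R n).
Implicit Types (i : chart_index M) (f : M -> R[i]).

Definition smooth_fun f := forall i,
  smooth_on (image_coord i) (fun y => complex.Re (f (param (atlas i) y))) /\
  smooth_on (image_coord i) (fun y => complex.Im (f (param (atlas i) y))).

Definition smooth_pred : {pred (M -> R[i])} := fun f => `[< smooth_fun f >].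

Lemma smooth_submod_closed : submod_closed smooth_pred.
Proof.
split=> [|a f g /asboolP sf /asboolP sg]; apply/asboolP => i.
  by split; exact: smooth_on_cst.
have oi : open (image_coord i) by exact: open_coord.
have [rf cf] := sf i; have [rg cg] := sg i; split.
- have := smooth_on_linear (complex.Re a) oi rf
    (smooth_on_linear (- complex.Im a) oi cf rg).
  by congr smooth_on; apply/funext => y; rewrite -Re_scaleD.
- have := smooth_on_linear (complex.Re a) oi cf
    (smooth_on_linear (complex.Im a) oi rf cg).
  by congr smooth_on; apply/funext => y; rewrite -Im_scaleD.
Qed.

HB.instance Definition _ := GRing.isSubmodClosed.Build _ _ smooth_pred
  smooth_submod_closed.

Record Cinf := MkCinf { Cinf_fun :> M -> R[i]; _ : Cinf_fun \in smooth_pred }.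

HB.instance Definition _ := [isSub for Cinf_fun].
HB.instance Definition _ := [Choice of Cinf by <:].
HB.instance Definition _ := [SubChoice_isSubLmodule of Cinf by <:].

Definition cpartial i (s : seq 'I_n) f (y : 'rV[R]_n) : R[i] :=
  partial s (fun z => complex.Re (f (param (atlas i) z))) y +i*
  partial s (fun z => complex.Im (f (param (atlas i) z))) y.

(* A seminorm is given by a chart, a compact set of values of its coordinates
   and the list of coordinates to differentiate along. *)
Definition Cinf_index : Type := chart_index M * set 'rV[R]_n * seq 'I_n.

Definition Cinf_indices : set Cinf_index :=
  [set k | compact k.1.2 /\ k.1.2 `<=` image_coord k.1.1].

Definition Cinf_seminorm (k : Cinf_index) (f : Cinf) : \bar R :=
  ereal_sup [set (normc (cpartial k.1.1 k.2 f y))%:E | y in k.1.2].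

Lemma cpartialD i s (f g : Cinf) y : image_coord i y ->
  cpartial i s (f + g) y = cpartial i s f y + cpartial i s g y.
Proof.
move=> iy; have oi : open (image_coord i) by exact: open_coord.
have /asboolP/(_ i)[rf cf] := valP f; have /asboolP/(_ i)[rg cg] := valP g.
apply/eqP; rewrite eq_complex !raddfD /=; apply/andP; split; apply/eqP.
  have := partial_linear 1 s oi rf rg iy; rewrite mul1r => <-.
  congr (partial s _ y); apply/funext => z.
  by rewrite mul1r -raddfD.
have := partial_linear 1 s oi cf cg iy; rewrite mul1r => <-.
congr (partial s _ y); apply/funext => z.
by rewrite mul1r -raddfD.
Qed.

Lemma Cinf_seminorm0 k : Cinf_indices k -> (Cinf_seminorm k 0%R <= 0)%E.
Proof.
move=> [_ kI]; apply: ub_ereal_sup => _ [y ky <-].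
have := @cpartialD k.1.1 k.2 0 0 y (kI _ ky).
rewrite addr0 => /eqP; rewrite -subr_eq subrr => /eqP <-.
by rewrite normc0.
Qed.

Lemma Cinf_seminormD k (f g : Cinf) : Cinf_indices k ->
  (Cinf_seminorm k (f + g)%R <= Cinf_seminorm k f + Cinf_seminorm k g)%E.
Proof.
move=> [_ kI]; apply: ub_ereal_sup => _ [y ky <-].
rewrite cpartialD; last exact: kI.
apply: (@le_trans _ _ ((normc (cpartial k.1.1 k.2 f y))%:E +
                       (normc (cpartial k.1.1 k.2 g y))%:E)%E).
  by rewrite -EFinD lee_fin le_normcD.
by apply: leeD; apply: ereal_sup_ubound; exists y.
Qed.

HB.instance Definition _ := hasNbhs.Build Cinf
  (nbhs_seminorms Cinf_indices Cinf_seminorm).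
HB.instance Definition _ := Nbhs_isNbhsTopological.Build Cinf
  (nbhs_seminorms_filter Cinf_seminorm0)
  (nbhs_seminorms_singleton Cinf_seminorm0)
  (nbhs_seminorms_nbhs Cinf_seminormD).

End smooth_functions.

Section distributions.
Context {R : realType} {n : nat} (M : oriented_manifold R n).

Definition distr_pred : {pred (Cinf M -> R[i])} :=
  fun u => `[< scalar u /\ continuous u >].

Lemma distr_submod_closed : submod_closed distr_pred.
Proof.
split=> [|a u v /asboolP[lu cu] /asboolP[lv cv]]; apply/asboolP.
  split=> [b f g|]; last exact: cst_continuous.
  by rewrite [RHS]addr0 [RHS]mulr0.
split=> [b f g|f].
  rewrite [LHS]/(a * u _ + v _) lu lv.
  rewrite [RHS]/(b * (a * u f + v f) + (a * u g + v g)).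
  have E (x y z w : R[i]) :
      a * (b * x + y) + (b * z + w) = b * (a * x + z) + (a * y + w).
    by rewrite !mulrDr mulrCA addrACA.
  exact: E.
apply: (@cvgD _ R[i]^o _ (nbhs f) (nbhs_filter f)); last exact: cv.
by apply: (@cvgZr _ R[i]^o _ (nbhs f) (nbhs_filter f)); exact: cu.
Qed.

HB.instance Definition _ := GRing.isSubmodClosed.Build _ _ distr_pred
  distr_submod_closed.

Record distr := MkDistr {
  distr_fun :> Cinf M -> R[i];
  _ : distr_fun \in distr_pred }.

HB.instance Definition _ := [isSub for distr_fun].
HB.instance Definition _ := [Choice of distr by <:].
HB.instance Definition _ := [SubChoice_isSubLmodule of distr by <:].

(* Uniform convergence on the bounded sets of Cinf: the strong dual topology. *)
Definition strong_seminorm (B : set (Cinf M)) (u : distr) : \bar R :=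
  ereal_sup [set (normc (u f))%:E | f in B].

Lemma strong_seminorm0 B :
  absorbed_bounded B -> (strong_seminorm B 0%R <= 0)%E.
Proof.
move=> _; apply: ub_ereal_sup => _ [f _ <-].
by rewrite [(0 : distr) f]/(0 : R[i]) normc0.
Qed.

Lemma strong_seminormD B (u v : distr) : absorbed_bounded B ->
  (strong_seminorm B (u + v)%R <= strong_seminorm B u + strong_seminorm B v)%E.
Proof.
move=> _; apply: ub_ereal_sup => _ [f Bf <-].
apply: (@le_trans _ _ ((normc (u f))%:E +
                       (normc (v f))%:E)%E).
  by rewrite -EFinD lee_fin [(u + v) f]/(u f + v f) le_normcD.
by apply: leeD; apply: ereal_sup_ubound; exists f.
Qed.

HB.instance Definition _ := hasNbhs.Build distr
  (nbhs_seminorms [set B | absorbed_bounded B] strong_seminorm).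
HB.instance Definition _ := Nbhs_isNbhsTopological.Build distr
  (nbhs_seminorms_filter strong_seminorm0)
  (nbhs_seminorms_singleton strong_seminorm0)
  (nbhs_seminorms_nbhs strong_seminormD).

End distributions.

Section operators.
Context {R : realType} {n : nat} {M : oriented_manifold R n}.
Variable vol : {measure set (borel M) -> \bar R}.
Implicit Types (u v w : distr M) (f g phi : Cinf M).

Definition cintegral (h : M -> R[i]) : R[i] :=
  (\int[vol]_(x in [set: borel M]) complex.Re (h x))%R +i*
  (\int[vol]_(x in [set: borel M]) complex.Im (h x))%R.

(* u is the distribution f vol with which f is identified. Statements about
   smooth functions seen as distributions go through this relation. *)
Definition is_function u f :=
  forall phi, u phi = cintegral (fun x => f x * phi x).

Definition smooth_distr u := exists f, is_function u f.

Variable P : distr M -> distr M.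

Definition preserves_smooth := forall u, smooth_distr u -> smooth_distr (P u).

(* P f = g as smooth functions *)
Definition maps_function f g :=
  exists2 u, is_function u f & is_function (P u) g.

Definition smooth_range : set (Cinf M) :=
  [set g | exists f, maps_function f g].

Definition globally_hypoelliptic :=
  forall u, smooth_distr (P u) -> smooth_distr u.

Definition almost_globally_hypoelliptic :=
  forall u, smooth_distr (P u) -> exists2 v, smooth_distr v & P v = P u.

(* w = tP v, where tP is the transpose of P acting on smooth functions *)
Definition is_transpose v w := forall f g, maps_function f g -> w f = v g.

Definition globally_solvable := forall f,
  (forall v, is_transpose v 0 -> v f = 0) -> exists h, maps_function h f.

End operators.

(* Main.v *)
Require Import Defs.
From mathcomp Require Import all_boot all_order all_algebra.
From mathcomp Require Import all_classical all_reals all_analysis.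
From mathcomp Require Import complex.
From mathcomp Require Import perm ring lra.
From mathcomp Require finmap.
Import Defs.

(** Write [K] for a finite cover of the compact manifold by coordinate balls,
    C^k-norms being taken over these balls. Call h a bounded image with bound C
    when h = Pv, as distributions, for some v with |v(phi)| <= C sup|phi|
    ([bounded_image]). Every h = Pu that is smooth is a bounded image: almost
    global hypoellipticity replaces u by a smooth function, and a smooth function
    is bounded for the dual uniform norm because the volume is finite. Two
    compactness facts carry the proof.

    - The ball of radius C for the dual uniform norm is compact for the dual
      C^1-norm ([dual_le_cluster]). Bounded functionals have weak cluster points,
      and by the argument of Arzela and Ascoli the C^1-ball of functions is
      totally bounded for the uniform norm, so that weak convergence is uniform
      on it.
    - P is weakly continuous for the dual C^1-norm ([continuous_dual_le]). Hence
      the bounded images with a given bound form a closed set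
      ([bounded_image_limit]).

    The pairs (u, h) with Pu = h, u bounded for the dual C^1-norm and h smooth,
    form a complete metrizable space, C^oo being complete for the countably many
    C^k-norms of the cover ([Cinf_complete], where the chain rule shows that a
    function smooth in the charts of the cover is smooth in every chart). It is
    the union over C of the closed sets where h is a bounded image with bound C,
    so that by Baire's theorem h is a bounded image with a fixed bound as soon as
    u and h are small ([local_bounded_image]).

    The smallness of u is then removed ([uniform_bounded_image]). Otherwise there
    would be bounded images h_j = P v_j with bound 1, not with bound 1/2, tending
    to 0. A cluster point v of the v_j satisfies Pv = 0, so h_j = P (v_j - v) with
    v_j - v arbitrarily small, and the local estimate makes h_j a bounded image
    with bound 1/2. The uniform estimate gives the closed range ([range_limit]):
    if P u_j tends to h, then P u_j - P u_0 = P v_j with bounded v_j, and a cluster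
    point v of the v_j satisfies Pv = h - P u_0, so that h is in the range by almost
    global hypoellipticity.

    If P is globally hypoelliptic, it is almost globally hypoelliptic, so the
    range is closed, and a function outside it is separated from it by a
    distribution by the theorem of Hahn and Banach ([separation]). That
    distribution is in the kernel of the transpose of P, so that the function is
    not orthogonal to this kernel. *)

Set Implicit Arguments.
Unset Strict Implicit.
Unset Printing Implicit Defensive.

Import Order.TTheory GRing.Theory Num.Theory.
Import numFieldNormedType.Exports.
Import ComplexField.Normc.

Local Open Scope classical_set_scope.
Local Open Scope ring_scope.

(** * Directional derivatives and Lipschitz estimates *)

Section directional.
Context {R : realType} {n : nat}.
Implicit Types (f : 'rV[R]_n -> R) (a v y z c : 'rV[R]_n).

(** Multiplied by h, the definition of a directional derivative involves no
    division and holds at h = 0 as well. *)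
Lemma is_derive_epsP f a v d : is_derive a v f d <->
  forall e, 0 < e -> exists2 r, 0 < r & forall h, `|h| < r ->
    `|f (h *: v + a) - f a - h * d| <= e * `|h|.
Proof.
split=> [[df <-] e e0|H].
  move/cvg_ex: (df) => [l dl]; rewrite /derive (cvg_lim _ dl)//.
  move/cvgrPdist_le : dl => /(_ e e0); rewrite near_withinE.
  move=> /nbhs_ballP[r /= r0 Hr]; exists r => // h hr.
  have [->|h0] := eqVneq h 0.
    by rewrite scale0r add0r subrr mul0r subr0 !normr0 mulr0.
  have := Hr h; rewrite /ball /= sub0r normrN => /(_ hr h0).
  rewrite distrC -[_ *: _]/(_ * _) => E.
  have -> : f (h *: v + a) - f a - h * l =
    (h^-1 * (f (h *: v + a) - f a) - l) * h.
    by rewrite mulrBl mulrAC mulVf// mul1r mulrC (mulrC l).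
  by rewrite normrM ler_wpM2r.
have cv : (fun h => h^-1 *: ((f \o shift a) (h *: v) - f a)) @ 0^' --> (d : R).
  apply/cvgrPdist_le => e e0; have [r r0 Hr] := H e e0.
  rewrite near_withinE; apply/nbhs_ballP; exists r => //= h.
  rewrite /ball /= sub0r normrN => hr h0.
  rewrite distrC -[_ *: _]/(_ * _).
  have := Hr h hr => E.
  have -> : h^-1 * (f (h *: v + a) - f a) - d =
    (f (h *: v + a) - f a - h * d) * h^-1.
    by rewrite [in RHS]mulrBl mulrC; congr (_ - _); rewrite mulrAC mulfV// mul1r.
  by rewrite normrM normfV ler_pdivrMr// normr_gt0.
split; first by apply/cvg_ex; exists d.
exact: (cvg_lim _ cv).
Qed.

Lemma is_derive_line f a v t d : is_derive (t *: v + a) v f d ->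
  is_derive t (1 : R) (fun s : R => f (s *: v + a)) d.
Proof.
move=> [df <-].
have E : (fun h : R => h^-1 *:
    ((f \o shift (t *: v + a)) (h *: v) - f (t *: v + a))) =
  (fun h : R => h^-1 *: (((fun s : R => f (s *: v + a)) \o shift t) (h *: 1) -
     f (t *: v + a))).
  apply/funext => h /=; congr (_ *: (f _ - _)).
  by rewrite [h *: 1]mulr1 scalerDl addrA.
split; first by rewrite /derivable -E.
by rewrite /derive -E.
Qed.

(** The mean value theorem applies to s |-> f (s t v + a) on [0, 1], whatever
    the sign of t. *)
Lemma segment_derive_le f a v (C t : R) : 0 <= C ->
  (forall s : R, 0 <= s <= 1 -> derivable f ((s * t) *: v + a) v /\
     `|'D_v f ((s * t) *: v + a)| <= C) ->
  `|f (t *: v + a) - f a| <= C * `|t|.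
Proof.
move=> C0 H.
pose g (s : R) := f (s *: (t *: v) + a).
have dg (s : R) : 0 <= s <= 1 ->
    is_derive s (1 : R) g ('D_v f ((s * t) *: v + a) * t).
  move=> s01; apply: is_derive_line; rewrite scalerA; apply/is_derive_epsP.
  have [df _] := H s s01; move: (derivableP df) => /is_derive_epsP Hd e e0.
  have [t0|t0] := eqVneq t 0.
    exists 1 => // h _; rewrite t0 scale0r scaler0 add0r subrr mulr0 mulr0.
    by rewrite subr0 normr0 mulr_ge0// ltW.
  have [r r0 Hr] := Hd (e / `|t|) (divr_gt0 e0 (eqbRL (normr_gt0 t) t0)).
  exists (r / `|t|); first by rewrite divr_gt0// normr_gt0.
  move=> h; rewrite ltr_pdivlMr ?normr_gt0// -normrM => /Hr.
  rewrite scalerA (_ : e / `|t| * `|h * t| = e * `|h|); last first.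
    by rewrite normrM [`|h| * _]mulrC mulrA divfK// normr_eq0.
  by rewrite [h * (_ * t)]mulrCA [_ * (h * t)]mulrC; apply.
have [||s] := @MVT_segment R g (fun s => 'D_v f ((s * t) *: v + a) * t) 0 1 ler01.
- by move=> s; rewrite in_itv/= => /andP[s0 s1]; apply: dg; rewrite (ltW s0) (ltW s1).
- apply: derivable_within_continuous => s; rewrite in_itv/= => s01.
  by have [] := dg s s01.
rewrite in_itv/= => s01; rewrite /g scale1r scale0r add0r subr0 mulr1 => ->.
by rewrite normrM ler_wpM2r//; have [] := H s s01.
Qed.

Lemma mx_entry_le (x : 'rV[R]_n) j : `|x 0 j| <= `|x|.
Proof.
by rewrite [leRHS]/Num.Def.normr/= mx_normrE; exact: (le_bigmax _ _ (ord0, j)).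
Qed.

Lemma mx_norm_le (x : 'rV[R]_n) e : 0 <= e -> (forall j, `|x 0 j| <= e) ->
  `|x| <= e.
Proof.
move=> e0 H; rewrite [leLHS]/Num.Def.normr/= mx_normrE; apply/bigmax_leP; split=> //.
by move=> [i j] _ /=; rewrite ord1.
Qed.

Lemma mx_norm_lt (x : 'rV[R]_n) e : 0 < e -> (forall j, `|x 0 j| < e) ->
  `|x| < e.
Proof.
move=> e0 H; rewrite [ltLHS]/Num.Def.normr/= mx_normrE; apply/bigmax_ltP; split=> //.
by move=> [i j] _ /=; rewrite ord1.
Qed.

Lemma ballE c r y : ball c r y <-> `|c - y| < r.
Proof. by rewrite -ball_normE. Qed.

(** Balls of 'rV are boxes, so that one can go from y to z inside the ball by
    changing the coordinates one at a time. *)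
Lemma ball_lipschitz f c r C : 0 <= C ->
  (forall y j, ball c r y -> derivable f y 'e_j /\ `|'D_('e_j) f y| <= C) ->
  forall y z, ball c r y -> ball c r z -> `|f y - f z| <= n%:R * C * `|y - z|.
Proof.
move=> C0 H y z cy cz.
have r0 : 0 < r by move/ballE: cy; apply: le_lt_trans.
pose p k : 'rV[R]_n := \row_j if (j < k)%N then y 0 j else z 0 j.
have cp (w : 'rV[R]_n) :
    (forall j, exists2 s : R, 0 <= s <= 1 & w 0 j = s * y 0 j + (1 - s) * z 0 j) ->
    ball c r w.
  move=> Hw; apply/ballE; apply: mx_norm_lt => // j.
  have [s s01 E] := Hw j; rewrite !mxE E.
  have cyj : `|c 0 j - y 0 j| < r.
    move/ballE: cy; apply: le_lt_trans.
    by have := mx_entry_le (c - y) j; rewrite !mxE.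
  have czj : `|c 0 j - z 0 j| < r.
    move/ballE: cz; apply: le_lt_trans.
    by have := mx_entry_le (c - z) j; rewrite !mxE.
  rewrite (_ : _ - _ = s * (c 0 j - y 0 j) + (1 - s) * (c 0 j - z 0 j)); last first.
    by ring.
  apply: le_lt_trans (ler_normD _ _) _; rewrite !normrM.
  have [s0 s1] := andP s01; rewrite (ger0_norm s0) [`|1 - s|]ger0_norm ?subr_ge0//.
  rewrite [ltRHS](_ : r = s * r + (1 - s) * r); last by ring.
  have [->|sn0] := eqVneq s 0; first by rewrite !mul0r !add0r subr0 !mul1r.
  by rewrite ltr_leD ?ler_wpM2l ?subr_ge0 ?(ltW czj)// ltr_pM2l// lt_neqAle eq_sym sn0.
have step k : (k <= n)%N -> `|f (p k) - f z| <= k%:R * C * `|y - z|.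
  elim: k => [_|k IH kn].
    rewrite !mul0r (_ : p 0 = z) ?subrr ?normr0//.
    by apply/rowP => j; rewrite mxE.
  have {IH} := IH (ltnW kn).
  pose j0 := Ordinal kn; pose t := y 0 j0 - z 0 j0.
  have pS : p k.+1 = t *: 'e_j0 + p k.
    apply/rowP => j; rewrite !mxE eqxx /= ltnS leq_eqVlt.
    have [->/=|jj0] := eqVneq j j0.
      by rewrite eqxx ltnn/= mulr1 subrK.
    by rewrite (_ : (j == k :> nat) = false) ?orFb ?mulr0 ?add0r//; apply/negbTE.
  have : `|f (p k.+1) - f (p k)| <= C * `|y - z|.
    rewrite pS; apply: le_trans (_ : C * `|t| <= _); last first.
      by rewrite ler_wpM2l//; have := mx_entry_le (y - z) j0; rewrite !mxE.
    apply: segment_derive_le => // s s01; apply: H; apply: cp => j.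
    rewrite !mxE eqxx /=; have [->|jj0] := eqVneq j j0.
      by exists s => //; rewrite ltnn mulr1 /t; ring.
    rewrite mulr0 add0r; case: ifP => _; [exists 1|exists 0].
    - by rewrite ler01 lexx.
    - by ring.
    - by rewrite lexx ler01.
    - by ring.
  move=> A B; rewrite -(subrKA (f (p k))).
  apply: le_trans (ler_normD _ _) _; rewrite -natr1 !mulrDl mul1r addrC.
  exact: lerD.
have := step n (leqnn n); rewrite (_ : p n = y)//.
by apply/rowP => j; rewrite mxE ltn_ord.
Qed.

End directional.

(** * The chain rule *)

Section chain_rule.
Context {R : realType}.

Lemma near_ballP {n} (a : 'rV[R]_n) (Q : 'rV[R]_n -> Prop) :
  (\forall y \near a, Q y) -> exists2 r, 0 < r & forall y, ball a r y -> Q y.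
Proof. by move/nbhs_ballP => [r /= r0 Hr]; exists r. Qed.

Lemma near0_abs (Q : R -> Prop) :
  (exists2 r, 0 < r & forall h, `|h| < r -> Q h) <-> \forall h \near 0, Q h.
Proof.
split=> [[r r0 Hr]|/nbhs_ballP[r /= r0 Hr]].
  by apply/nbhs_ballP; exists r => //= h; rewrite /ball/= sub0r normrN; exact: Hr.
by exists r => // h hr; apply: Hr; rewrite /ball/= sub0r normrN.
Qed.

(** Subtracting from f its linear part at a leaves a function whose partial
    derivatives are small near a, hence a function with a small Lipschitz
    constant. *)
Lemma C1_linear_approx {n} (f : 'rV[R]_n -> R) (a : 'rV[R]_n) :
  (\forall y \near a, forall j, derivable f y 'e_j) ->
  (forall j, {for a, continuous ('D_('e_j) f)}) ->
  forall e, 0 < e -> \forall y \near a,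
    `|f y - f a - \sum_j (y 0 j - a 0 j) * 'D_('e_j) f a| <= e * `|y - a|.
Proof.
move=> df cf e e0; pose d := e / n.+1%:R.
have d0 : 0 < d by rewrite divr_gt0.
have nc : \forall y \near a, forall j, `|'D_('e_j) f y - 'D_('e_j) f a| <= d.
  apply: (@filter_forall _ _ (fun j y => `|'D_('e_j) f y - 'D_('e_j) f a| <= d)
    (nbhs a) (nbhs_filter a)).
  move=> j; have /cvgrPdist_le/(_ d d0) := cf j.
  by apply: filterS => y; rewrite distrC.
have [r r0 Hr] := near_ballP (filterI df nc).
pose F y := f y - \sum_j y 0 j * 'D_('e_j) f a.
have dF y j : ball a r y ->
    is_derive y 'e_j F ('D_('e_j) f y - 'D_('e_j) f a).
  move=> /Hr[/(_ j) dfy _].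
  suff dL : is_derive y 'e_j (fun z : 'rV[R]_n => \sum_j z 0 j * 'D_('e_j) f a)
      ('D_('e_j) f a) by have dfP := derivableP dfy; exact: is_deriveB.
  apply/is_derive_epsP => e1 e10; exists 1 => // h _.
  rewrite (_ : _ - _ = 0) ?normr0 ?mulr_ge0// ?(ltW e10)//.
  rewrite -sumrB (bigD1 j)//= big1 ?addr0; last first.
    by move=> k kj; rewrite !mxE eqxx/= (negbTE kj) mulr0 add0r subrr.
  by rewrite !mxE !eqxx /= mulr1 mulrDl addrK subrr.
apply/nbhs_ballP; exists r => //= y ay.
have aa : ball a r a by exact: ballxx.
have := @ball_lipschitz R n F a r d (ltW d0) _ y a ay aa.
rewrite (_ : _ - _ - _ = F y - F a); last first.
  rewrite /F (_ : \sum_j (y 0 j - a 0 j) * _ =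
    \sum_j y 0 j * 'D_('e_j) f a - \sum_j a 0 j * 'D_('e_j) f a); first by ring.
  by rewrite -sumrB; apply: eq_bigr => j _; rewrite mulrBl.
move=> H; apply: le_trans (H _) _.
  move=> z j az; have [ez dz] := dF z j az; split => //.
  by rewrite dz; have [_] := Hr z az; apply.
rewrite ler_wpM2r// /d mulrCA ler_piMr ?(ltW e0)//.
by rewrite ler_pdivrMr// mul1r ler_nat.
Qed.

(** As f is linear up to a small error, only the derivatives of the
    coordinates of p in the one direction v matter. *)
Lemma is_derive_comp_rV {m n} (f : 'rV[R]_n -> R) (p : 'rV[R]_m -> 'rV[R]_n)
    (x v : 'rV[R]_m) :
  (\forall y \near p x, forall j, derivable f y 'e_j) ->
  (forall j, {for p x, continuous ('D_('e_j) f)}) ->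
  (forall k, derivable (fun z => p z 0 k) x v) ->
  is_derive x v (f \o p)
    (\sum_k 'D_('e_k) f (p x) * 'D_v (fun z => p z 0 k) x).
Proof.
move=> df cf dp; apply/is_derive_epsP => e e0.
pose D : 'rV[R]_n := \row_k 'D_v (fun z => p z 0 k) x.
pose S := \sum_k `|'D_('e_k) f (p x)|.
have S0 : 0 <= S by apply: sumr_ge0.
pose t := e / 2 / (S + 1); have t0 : 0 < t.
  by rewrite !divr_gt0// ltr_pwDr.
pose d := e / 2 / (`|D| + t); have d0 : 0 < d.
  by rewrite !divr_gt0// ltr_wpDl.
have [r r0 Hr] := near_ballP (C1_linear_approx df cf d0).
have np : \forall h \near (0 : R), forall k,
    `|p (h *: v + x) 0 k - p x 0 k - h * D 0 k| <= t * `|h|.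
  apply: (@filter_forall _ _ (fun k (h : R) =>
    `|p (h *: v + x) 0 k - p x 0 k - h * D 0 k| <= t * `|h|)
    (nbhs 0) (nbhs_filter 0)) => k; apply/near0_abs.
  by move: (derivableP (dp k)) => /is_derive_epsP/(_ t t0); rewrite mxE.
move/near0_abs: np => [r1 r10 Hr1].
have pB h : `|h| < r1 -> `|p (h *: v + x) - p x| <= (`|D| + t) * `|h|.
  move=> /Hr1 H; apply: mx_norm_le; first by rewrite mulr_ge0// addr_ge0// ltW.
  move=> k; have := H k; rewrite !mxE => Hk.
  rewrite -(subrK (h * 'D_v (fun z : 'rV_m => p z 0 k) x) (_ - _)).
  apply: le_trans (ler_normD _ _) _; rewrite addrC mulrDl lerD//.
  rewrite normrM mulrC ler_wpM2r//.
  by have := mx_entry_le D k; rewrite mxE.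
exists (Num.min r1 (r / (`|D| + t))).
  by rewrite lt_min r10 divr_gt0// ltr_wpDl.
move=> h; rewrite lt_min => /andP[hr1]; rewrite ltr_pdivlMr ?ltr_wpDl// => hr.
rewrite mulrC in hr.
have := Hr (p (h *: v + x)); rewrite ballE distrC => /(_ (le_lt_trans (pB h hr1) hr)).
set A := \sum_j _ => HA /=.
set B := \sum_k _.
rewrite (_ : _ - _ - _ = (f (p (h *: v + x)) - f (p x) - A) + (A - h * B)); last first.
  by ring.
apply: le_trans (ler_normD _ _) _.
rewrite (_ : e * `|h| = e / 2 * `|h| + e / 2 * `|h|); last by field.
apply: lerD.
  apply: le_trans HA _; apply: le_trans (_ : d * ((`|D| + t) * `|h|) <= _).
    by apply: ler_wpM2l; [exact: ltW|exact: pB].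
  by rewrite mulrA /d divfK// gt_eqF// ltr_wpDl.
apply: le_trans (_ : S * (t * `|h|) <= _); last first.
  rewrite mulrA ler_wpM2r// /t mulrCA ler_piMr ?divr_ge0 ?(ltW e0)//.
  by rewrite ler_pdivrMr ?ltr_wpDl// mul1r lerDl.
rewrite /A /B mulr_sumr -sumrB /S mulr_suml.
apply: le_trans (ler_norm_sum _ _ _) _; apply: ler_sum => k _.
rewrite (_ : _ - _ = 'D_('e_k) f (p x) *
    (p (h *: v + x) 0 k - p x 0 k - h * D 0 k)); last by rewrite mxE; ring.
by rewrite normrM ler_wpM2l//; exact: Hr1.
Qed.

End chain_rule.

(** * Uniform limits of derivatives *)

Section uniform_limit.
Context {R : realType} {n : nat}.

(** The mean value inequality bounds the increments of [h j - h N] uniformly in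
    j, hence also those of [h0 - h N]. *)
Lemma is_derive_uniform_limit (U : set 'rV[R]_n) (h : nat -> 'rV[R]_n -> R)
    (h0 d : 'rV[R]_n -> R) v : open U ->
  (forall j z, U z -> derivable (h j) z v) ->
  (forall z, U z -> h ^~ z @ \oo --> h0 z) ->
  (forall e, 0 < e -> \forall j \near \oo, forall z, U z ->
     `|'D_v (h j) z - d z| <= e) ->
  forall y, U y -> is_derive y v h0 (d y).
Proof.
move=> oU dh hh0 hd y Uy; apply/is_derive_epsP => e e0.
have e4 : 0 < e / 4 by rewrite divr_gt0.
have [N _ HN] := hd _ e4.
move: (derivableP (dh N y Uy)) => /is_derive_epsP/(_ _ e4)[r r0 Hr].
have /near0_abs[r1 r10 Hr1] : \forall t \near (0 : R), U (t *: v + y).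
  have : nbhs (0 *: v + y) U.
    by rewrite scale0r add0r; apply: open_nbhs_nbhs.
  have : {for 0 : R, continuous (fun t : R => t *: v + y)}.
    apply: cvgD; last exact: cvg_cst.
    exact: scalel_continuous.
  by move=> /(_ U).
exists (Num.min r r1); first by rewrite lt_min r0.
move=> t; rewrite lt_min => /andP[tr tr1].
pose g j z := h j z - h N z.
have gle j : (N <= j)%N -> `|g j (t *: v + y) - g j y| <= e / 2 * `|t|.
  move=> Nj; apply: segment_derive_le; first by rewrite divr_ge0// ltW.
  move=> s /andP[s0 s1].
  have Us : U ((s * t) *: v + y).
    by apply: Hr1; rewrite normrM ger0_norm// (le_lt_trans _ tr1)// ler_piMl.
  have [dj dN] := (dh j _ Us, dh N _ Us).
  split; first exact: derivableB.
  rewrite deriveB//.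
  rewrite (_ : _ - _ = ('D_v (h j) ((s * t) *: v + y) - d ((s * t) *: v + y)) -
     ('D_v (h N) ((s * t) *: v + y) - d ((s * t) *: v + y))); last by ring.
  apply: le_trans (ler_normB _ _) _.
  rewrite (_ : e / 2 = e / 4 + e / 4); last by field.
  by apply: lerD; apply: HN => //=.
have g0le : `|(h0 (t *: v + y) - h N (t *: v + y)) - (h0 y - h N y)| <= e / 2 * `|t|.
  have cg : (fun j => `|g j (t *: v + y) - g j y|) @ \oo -->
      `|(h0 (t *: v + y) - h N (t *: v + y)) - (h0 y - h N y)|.
    apply: cvg_norm; apply: cvgB; apply: cvgB; try exact: cvg_cst.
      by apply: hh0; exact: Hr1.
    exact: hh0.
  rewrite -(cvg_lim _ cg)//; apply: limr_le; first by apply/cvg_ex; eexists; exact: cg.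
  by exists N => // j /= Nj; exact: gle.
have HNy := HN N (leqnn N) y Uy.
rewrite (_ : _ - _ - _ = ((h0 (t *: v + y) - h N (t *: v + y)) - (h0 y - h N y)) +
  ((h N (t *: v + y) - h N y - t * 'D_v (h N) y) + ('D_v (h N) y - d y) * t)); last by ring.
rewrite (_ : e * `|t| = e / 2 * `|t| + (e / 4 * `|t| + e / 4 * `|t|)); last by field.
apply: le_trans (ler_normD _ _) _; rewrite lerD//.
apply: le_trans (ler_normD _ _) _; rewrite lerD ?Hr//.
by rewrite normrM ler_wpM2r.
Qed.

End uniform_limit.

(** * Calculus of smooth functions *)

Section smooth_calculus.
Context {R : realType}.

(** [partial] prepends derivatives on the outside. The calculus rules act on
    the innermost derivative, which [smooth_uptoS] isolates for the inductions
    on k. *)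
Definition smooth_upto {n} (k : nat) (U : set 'rV[R]_n) (f : 'rV[R]_n -> R) :=
  forall s, (size s <= k)%N -> forall y, U y ->
  {for y, continuous (partial s f)} /\
  forall j, derivable (partial s f) y 'e_j.

Lemma smooth_onE {n} (U : set 'rV[R]_n) f :
  smooth_on U f <-> forall k, smooth_upto k U f.
Proof. by split=> [H k s _|H s]; [exact: H|exact: (H (size s))]. Qed.

Lemma partial_rcons {n} (f : 'rV[R]_n -> R) s j :
  partial (rcons s j) f = partial s ('D_('e_j) f).
Proof. by elim: s => //= i s ->. Qed.

Lemma smooth_upto0 {n} (U : set 'rV[R]_n) f : smooth_upto 0 U f <->
  forall y, U y -> {for y, continuous f} /\ forall j, derivable f y 'e_j.
Proof.
split=> [H y Uy|H [|//] _ y Uy]; last exact: H.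
exact: (H [::]).
Qed.

Lemma smooth_uptoS {n} (U : set 'rV[R]_n) f k : smooth_upto k.+1 U f <->
  smooth_upto 0 U f /\ forall j, smooth_upto k U ('D_('e_j) f).
Proof.
split=> [H|[H0 HS] s].
  split=> [s s0|j s sk]; first by apply: H; rewrite (leq_trans s0).
  by rewrite -partial_rcons; apply: H; rewrite size_rcons.
case/lastP: s => [_|s j]; first exact: H0.
by rewrite size_rcons partial_rcons ltnS => sk; exact: HS.
Qed.

Lemma smooth_on_derive {n} (U : set 'rV[R]_n) f j :
  smooth_on U f -> smooth_on U ('D_('e_j) f).
Proof. by move=> sf s; rewrite -partial_rcons; exact: sf. Qed.

Lemma smooth_uptoW {n} (U : set 'rV[R]_n) f k :
  smooth_upto k.+1 U f -> smooth_upto k U f.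
Proof. by move=> H s sk; apply: H; rewrite (leq_trans sk). Qed.

Lemma near_open {n} (U : set 'rV[R]_n) (f g : 'rV[R]_n -> R) :
  open U -> (forall y, U y -> f y = g y) ->
  forall y, U y -> {near y, f =1 g}.
Proof.
move=> oU fg y Uy; near=> z; apply: fg; near: z; exact: open_nbhs_nbhs.
Unshelve. all: by end_near. Qed.

Lemma partial_eq_on {n} (U : set 'rV[R]_n) (f g : 'rV[R]_n -> R) s :
  open U -> (forall y, U y -> f y = g y) ->
  forall y, U y -> partial s f y = partial s g y.
Proof.
move=> oU fg; elim: s => [//|j s IH] y Uy /=.
by apply: near_eq_derive; exact: near_open oU IH _ Uy.
Qed.

Lemma smooth_upto_eq {n} (U : set 'rV[R]_n) (f g : 'rV[R]_n -> R) k :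
  open U -> (forall y, U y -> f y = g y) ->
  smooth_upto k U f -> smooth_upto k U g.
Proof.
move=> oU fg sf s sk y Uy; have [cf df] := sf s sk y Uy.
have nE := near_open oU (partial_eq_on s oU fg) Uy.
split=> [|j]; last exact: near_eq_derivable nE (df j).
rewrite /prop_for /continuous_at -(nbhs_singleton nE).
exact: cvg_trans (near_eq_cvg nE) cf.
Qed.

Lemma smooth_uptoD {n} (U : set 'rV[R]_n) f g k : open U ->
  smooth_upto k U f -> smooth_upto k U g ->
  smooth_upto k U (fun z => f z + g z).
Proof.
have D0 f' g' : smooth_upto 0 U f' -> smooth_upto 0 U g' ->
    smooth_upto 0 U (fun z => f' z + g' z).
  move=> /smooth_upto0 sf /smooth_upto0 sg; apply/smooth_upto0 => y Uy.
  have [[cf df] [cg dg]] := (sf y Uy, sg y Uy).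
  by split=> [|j]; [exact: (cvgD cf cg)|exact: (derivableD (df j) (dg j))].
move=> oU; elim: k f g => [|k IH] f g; first exact: D0.
move=> /smooth_uptoS[f0 fS] /smooth_uptoS[g0 gS]; apply/smooth_uptoS.
split=> [|j]; first exact: D0.
apply: smooth_upto_eq oU _ (IH _ _ (fS j) (gS j)) => y Uy.
move/smooth_upto0 : f0 => /(_ y Uy)[_ df].
move/smooth_upto0 : g0 => /(_ y Uy)[_ dg].
by rewrite [RHS](deriveD (df j) (dg j)).
Qed.

Lemma smooth_uptoM {n} (U : set 'rV[R]_n) f g k : open U ->
  smooth_upto k U f -> smooth_upto k U g ->
  smooth_upto k U (fun z => f z * g z).
Proof.
have M0 f' g' : smooth_upto 0 U f' -> smooth_upto 0 U g' ->
    smooth_upto 0 U (fun z => f' z * g' z).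
  move=> /smooth_upto0 sf /smooth_upto0 sg; apply/smooth_upto0 => y Uy.
  have [[cf df] [cg dg]] := (sf y Uy, sg y Uy).
  by split=> [|j]; [exact: (cvgM cf cg)|exact: (derivableM (df j) (dg j))].
move=> oU; elim: k f g => [|k IH] f g; first exact: M0.
move=> sf sg; have [sf' sg'] := (smooth_uptoW sf, smooth_uptoW sg).
move: sf sg => /smooth_uptoS[f0 fS] /smooth_uptoS[g0 gS]; apply/smooth_uptoS.
split; first exact: M0.
move=> j; apply: smooth_upto_eq oU _
  (smooth_uptoD oU (IH _ _ sf' (gS j)) (IH _ _ sg' (fS j))) => y Uy.
move/smooth_upto0 : f0 => /(_ y Uy)[_ df].
move/smooth_upto0 : g0 => /(_ y Uy)[_ dg].
by rewrite [RHS](deriveM (df j) (dg j)).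
Qed.

Lemma smooth_upto_sum {n} (U : set 'rV[R]_n) (I : Type) (r : seq I) F k : open U ->
  (forall i, smooth_upto k U (F i)) ->
  smooth_upto k U (fun z => \sum_(i <- r) F i z).
Proof.
move=> oU sF; elim: r => [|i r IH].
  apply: (@smooth_upto_eq _ _ (fun=> 0)) => //; first by move=> y _; rewrite big_nil.
  have /smooth_onE : smooth_on U (fun=> 0 : R) by exact: smooth_on_cst.
  exact.
apply: (@smooth_upto_eq _ _ (fun z => F i z + \sum_(i <- r) F i z)) => //.
  by move=> y _; rewrite big_cons.
exact: smooth_uptoD.
Qed.

Lemma rV_continuous {m n} (p : 'rV[R]_m -> 'rV[R]_n) x :
  (forall k, {for x, continuous (fun z => p z 0 k)}) -> {for x, continuous p}.
Proof.
move=> cp; apply/(@cvgrPdist_le R 'rV[R]_n _ (nbhs x) (nbhs_filter x)) => e e0.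
have H : \forall z \near x, forall k, `|p x 0 k - p z 0 k| <= e.
  apply: (@filter_forall _ _ (fun k (z : 'rV[R]_m) => `|p x 0 k - p z 0 k| <= e)
    (nbhs x) (nbhs_filter x)) => k.
  by have /cvgrPdist_le/(_ e e0) := cp k.
apply: (@filterS _ _ (nbhs_filter x) _ _ _ H) => z Hz.
apply: mx_norm_le; first exact: ltW.
by move=> k; rewrite !mxE.
Qed.

(** By the chain rule, the first partial derivatives of a composite are sums of
    products of a composite with a coordinate derivative, which allows an
    induction on the order of differentiation. *)
Lemma smooth_on_comp {m n} (V : set 'rV[R]_m) (U : set 'rV[R]_n) f
    (p : 'rV[R]_m -> 'rV[R]_n) : open V -> open U ->
  (forall x, V x -> U (p x)) ->
  (forall k, smooth_on V (fun z => p z 0 k)) -> smooth_on U f ->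
  smooth_on V (f \o p).
Proof.
move=> oV oU VU sp sf; apply/smooth_onE => k; move: f sf.
have chain f x j : smooth_on U f -> V x -> is_derive x 'e_j (f \o p)
    (\sum_k 'D_('e_k) f (p x) * 'D_('e_j) (fun z => p z 0 k) x).
  move=> sf Vx; have Up := VU _ Vx; apply: is_derive_comp_rV.
  - near=> y => i; apply: (sf [::] y _).2; near: y; exact: open_nbhs_nbhs.
  - by move=> i; have [] := sf [:: i] _ Up.
  - by move=> i; have [_ /(_ j)] := sp i [::] x Vx.
have C0 f : smooth_on U f -> smooth_upto 0 V (f \o p).
  move=> sf; apply/smooth_upto0 => x Vx; split=> [|j].
    apply: continuous_comp; last by have [] := sf [::] _ (VU _ Vx).
    by apply: rV_continuous => i; have [] := sp i [::] x Vx.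
  by have [] := chain f x j sf Vx.
elim: k => [//|k IH] f sf; apply/smooth_uptoS; split; first exact: C0.
move=> j; apply: (@smooth_upto_eq _ _ (fun x =>
    \sum_k 'D_('e_k) f (p x) * 'D_('e_j) (fun z => p z 0 k) x)) => //.
  by move=> x Vx; have [_ ->] := chain f x j sf Vx.
apply: smooth_upto_sum => // i; apply: smooth_uptoM => //.
  by apply: (IH ('D_('e_i) f)); exact: smooth_on_derive.
by have /smooth_onE H := smooth_on_derive j (sp i); exact: H.
Unshelve. all: by end_near. Qed.

Lemma smooth_on_eq {n} (U : set 'rV[R]_n) (f g : 'rV[R]_n -> R) :
  open U -> (forall y, U y -> f y = g y) -> smooth_on U f -> smooth_on U g.
Proof.
by move=> oU fg /smooth_onE sf; apply/smooth_onE => k; exact: smooth_upto_eq oU fg (sf k).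
Qed.

End smooth_calculus.

(** * Real and imaginary parts *)

Section reim.
Context {R : rcfType}.
Implicit Types (z w : R[i]) (b : bool).

Definition reim b z : R := if b then complex.Re z else complex.Im z.

Lemma reimD b z w : reim b (z + w) = reim b z + reim b w.
Proof. by case: b; rewrite /= raddfD. Qed.

Lemma reimN b z : reim b (- z) = - reim b z.
Proof. by case: b; rewrite /= raddfN. Qed.

Lemma reimB b z w : reim b (z - w) = reim b z - reim b w.
Proof. by rewrite reimD reimN. Qed.

Lemma reimZ b (a : R) z : reim b (a%:C%C * z) = a * reim b z.
Proof. by case: b z => [] [x y]; rewrite /= mul0r ?subr0 ?addr0. Qed.

Lemma reimP z w : (forall b, reim b z = reim b w) -> z = w.
Proof.
by case: z w => [x y] [x' y'] H; rewrite (H true : x = x') (H false : y = y').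
Qed.

Lemma reim_le_normc b z : `|reim b z| <= normc z.
Proof.
case: z => x y; rewrite /normc -sqrtr_sqr ler_sqrt ?addr_ge0 ?sqr_ge0//.
by case: b; rewrite /= ?lerDl ?lerDr sqr_ge0.
Qed.

Lemma normc_ge0 z : 0 <= normc z.
Proof. by case: z => x y; exact: sqrtr_ge0. Qed.

Lemma normc_le_reim z e : (forall b, `|reim b z| <= e) -> normc z <= 2 * e.
Proof.
case: z => x y H; have [/= hx hy] := (H true, H false).
have e0 : 0 <= e by apply: le_trans hx.
rewrite /normc -[leRHS]ger0_norm ?mulr_ge0// -sqrtr_sqr ler_sqrt ?sqr_ge0//.
rewrite exprMn.
have : x ^+ 2 <= e ^+ 2.
  by rewrite -[x ^+ 2]real_normK ?num_real// lerXn2r ?nnegrE.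
have : y ^+ 2 <= e ^+ 2.
  by rewrite -[y ^+ 2]real_normK ?num_real// lerXn2r ?nnegrE.
have : 0 <= e ^+ 2 by rewrite sqr_ge0.
rewrite -natrX; lra.
Qed.

Lemma normcZ (a : R) z : normc (a%:C%C * z) = `|a| * normc z.
Proof.
by rewrite normcM; congr (_ * _); rewrite /normc/= expr0n/= addr0 sqrtr_sqr.
Qed.

Lemma scalecN1 (V : lmodType R[i]) (v : V) : (-1 : R)%:C%C *: v = - v.
Proof.
by rewrite (_ : _%:C%C = -1) ?scaleN1r//; apply/eqP; rewrite eq_complex/= oppr0 !eqxx.
Qed.

Lemma scalec1 (V : lmodType R[i]) (v : V) : (1 : R)%:C%C *: v = v.
Proof. exact: scale1r. Qed.

End reim.

(** * Covers by coordinate balls *)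

(** The closed balls are compact sets of coordinates inside the charts, which
    bounds continuous functions on the open balls. *)
Record good_cover (R : realType) (n : nat) (M : oriented_manifold R n) :=
  GoodCover {
  centers : seq M;
  chart_at : M -> chart_index M;
  radius : M -> R;
  radius_gt0 : forall z, 0 < radius z;
  closed_ball_chart : forall z,
    closed_ball (coord (atlas (chart_at z)) z) (radius z) `<=`
    image_coord (chart_at z);
  balls_cover : forall x, exists2 z, z \in centers &
    dom (atlas (chart_at z)) x /\
    ball (coord (atlas (chart_at z)) z) (radius z) (coord (atlas (chart_at z)) x) }.

Section good_cover.
Context {R : realType} {n : nat} {M : oriented_manifold R n}.

Lemma coord_continuous_at (c : chart R n M) x : dom c x ->
  {for x, continuous (coord c)}.
Proof.
move=> cx; have := @continuous_coord _ _ _ c.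
rewrite (continuous_open_subspace _ (open_dom c)) => /(_ x).
by apply; exact: mem_set.
Qed.

Lemma param_continuous_at (c : chart R n M) y : (coord c @` dom c) y ->
  {for y, continuous (param c)}.
Proof.
move=> cy; have := @continuous_param _ _ _ c.
rewrite (continuous_open_subspace _ (@open_coord _ _ _ c)) => /(_ y).
by apply; exact: mem_set.
Qed.

Lemma chart_open (c : chart R n M) (U : set 'rV[R]_n) : open U ->
  open (dom c `&` coord c @^-1` U).
Proof.
move=> oU; rewrite openE => x [cx Ux]; apply: filterI.
  by apply: open_nbhs_nbhs; split => //; exact: open_dom.
by apply: (coord_continuous_at cx); exact: open_nbhs_nbhs.
Qed.

Lemma good_cover_exists : compact [set: M] -> inhabited (good_cover M).
Proof.
move=> Mc.
have /choice[ir Hir] (z : M) : exists ir : chart_index M * R,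
    [/\ 0 < ir.2, dom (atlas ir.1) z &
      closed_ball (coord (atlas ir.1) z) ir.2 `<=` image_coord ir.1].
  have [i iz] := atlas_cover z.
  have : nbhs (coord (atlas i) z) (image_coord i).
    by apply: open_nbhs_nbhs; split; [exact: open_coord|exists z].
  by move=> /nbhs_closedballP[r Hr]; exists (i, r%:num); split=> /=.
pose U (z : M) := dom (atlas (ir z).1) `&` coord (atlas (ir z).1) @^-1`
   ball (coord (atlas (ir z).1) z) (ir z).2.
have oU z : open (U z) by apply: chart_open; exact: ball_open.
have := Mc; rewrite compact_cover => /(_ M setT U).
case=> [z _ //|x _|D _ HD].
  exists x => //; have [r0 dx _] := Hir x; split => //=; exact: ballxx.
constructor; exists (finmap.enum_fset D) (fun z => (ir z).1) (fun z => (ir z).2).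
- by move=> z; have [] := Hir z.
- by move=> z; have [] := Hir z.
- by move=> x; have [z zD [? ?]] := HD x I; exists z.
Qed.

End good_cover.

(** * Norms of class C^k over a cover *)

Section seminorms.
Context {R : realType} {n : nat} {M : oriented_manifold R n} (K : good_cover M).
Implicit Types (f g : Cinf M) (z : M) (s : seq 'I_n) (b : bool).

Definition local_rep b z (f : M -> R[i]) (y : 'rV[R]_n) : R :=
  reim b (f (param (atlas (chart_at K z)) y)).

Definition region z :=
  ball (coord (atlas (chart_at K z)) z) (radius K z).

Definition closed_region z :=
  closed_ball (coord (atlas (chart_at K z)) z) (radius K z).

(** That e bounds the C^k-norm of f is stated as a relation, which avoids suprema
    and the question of their finiteness. *)
Definition deriv_le (k : nat) (f : M -> R[i]) (e : R) :=
  forall b z s, z \in centers K -> (size s <= k)%N ->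
  forall y, region z y -> `|partial s (local_rep b z f) y| <= e.

Lemma region_closed z : region z `<=` closed_region z.
Proof. exact: subset_closed_ball. Qed.

Lemma closed_region_image z : closed_region z `<=` image_coord (chart_at K z).
Proof. exact: closed_ball_chart. Qed.

Lemma region_image z : region z `<=` image_coord (chart_at K z).
Proof. by apply: subset_trans (@closed_region_image z); exact: region_closed. Qed.

Lemma region_open z : open (region z).
Proof. exact: ball_open. Qed.

Lemma image_coord_open (i : chart_index M) : open (image_coord i).
Proof. exact: open_coord. Qed.

Lemma closed_region_compact z : compact (closed_region z).
Proof.
apply: bounded_closed_compact; last exact: closed_ball_closed.
rewrite /closed_region closed_ballE ?radius_gt0//.
set c := coord _ _; exists (`|c| + radius K z); split; first exact: num_real.
move=> e He y; rewrite /closed_ball_ /= => cy; apply: le_trans (ltW He).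
rewrite -[y](subrK c) addrC; apply: le_trans (ler_normD _ _) _.
by rewrite lerD// distrC.
Qed.

Lemma Cinf_smooth (f : Cinf M) i b :
  smooth_on (image_coord i) (fun y => reim b (f (param (atlas i) y))).
Proof. by have /asboolP/(_ i)[? ?] := valP f; case: b. Qed.

Lemma local_rep_smooth b z f :
  smooth_on (image_coord (chart_at K z)) (local_rep b z f).
Proof. exact: Cinf_smooth. Qed.

Lemma partial_zero s y : partial s (fun=> 0) y = 0 :> R.
Proof.
suff -> : partial s (fun=> 0 : R) = fun=> 0 by [].
by elim: s => //= j s ->; apply/funext => w; exact: derive_cst.
Qed.

Lemma partial_lin (U : set 'rV[R]_n) (h1 h2 h : 'rV[R]_n -> R) (a : R) s : open U ->
  smooth_on U h1 -> smooth_on U h2 ->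
  (forall y, U y -> h y = a * h1 y + h2 y) ->
  forall y, U y -> partial s h y = a * partial s h1 y + partial s h2 y.
Proof.
move=> oU s1 s2 E y Uy; rewrite -(partial_linear a s oU s1 s2 Uy).
exact: (partial_eq_on s oU E).
Qed.

Lemma partial_repZD b z s (a : R) f g y : region z y ->
  partial s (local_rep b z (a%:C%C *: f + g)) y =
  a * partial s (local_rep b z f) y + partial s (local_rep b z g) y.
Proof.
move=> /region_image zy; apply: partial_lin (@image_coord_open _) _ _ _ _ zy.
- exact: local_rep_smooth.
- exact: local_rep_smooth.
- by move=> w _; rewrite /local_rep -reimZ -reimD.
Qed.

Lemma partial_repB b z s f g y : region z y ->
  partial s (local_rep b z (f - g)) y =
  partial s (local_rep b z f) y - partial s (local_rep b z g) y.
Proof.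
move=> zy; have := partial_repZD b s (-1) g f zy.
by rewrite scalecN1 addrC => ->; rewrite mulN1r addrC.
Qed.

Lemma deriv_le_ge0 k f e : deriv_le k f e -> 0 <= e.
Proof.
move=> H; have [z zL [_ zx]] := balls_cover K (point : M).
by apply: le_trans (normr_ge0 _) (H true z [::] zL _ _ zx).
Qed.

Lemma deriv_leW k l f e d : (l <= k)%N -> e <= d ->
  deriv_le k f e -> deriv_le l f d.
Proof.
move=> lk ed H b z s zL sl y zy; apply: le_trans (H b z s zL _ y zy) ed.
exact: leq_trans lk.
Qed.

Lemma deriv_le0P f e : (forall x b, `|reim b (f x)| <= e) <-> deriv_le 0 f e.
Proof.
split=> [H b z [|//] _ _ y _ /=|H x b]; first exact: H.
have [z zL [dx zx]] := balls_cover K x.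
by have := H b z [::] zL isT _ zx; rewrite /= /local_rep coordK.
Qed.

Lemma deriv_leZD k (a : R) f g e d : deriv_le k f e -> deriv_le k g d ->
  deriv_le k (a%:C%C *: f + g) (`|a| * e + d).
Proof.
move=> fe gd b z s zL sk y zy; rewrite partial_repZD//.
apply: le_trans (ler_normD _ _) _; rewrite normrM lerD//; last exact: gd.
by rewrite ler_wpM2l//; exact: fe.
Qed.

Lemma deriv_le0 k : deriv_le k (0 : Cinf M) 0.
Proof.
move=> b z s zL sk y zy; have := partial_repZD b s 1 0 0 zy.
rewrite scalec1 addr0 mul1r => /eqP.
by rewrite -subr_eq subrr => /eqP <-; rewrite normr0.
Qed.

Lemma deriv_leZ k (a : R) f e :
  deriv_le k f e -> deriv_le k (a%:C%C *: f) (`|a| * e).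
Proof. by move=> fe; have := deriv_leZD a fe (@deriv_le0 k); rewrite !addr0. Qed.

Lemma deriv_leD k f g e d : deriv_le k f e -> deriv_le k g d ->
  deriv_le k (f + g) (e + d).
Proof.
by move=> fe gd; have := deriv_leZD 1 fe gd; rewrite scalec1 normr1 mul1r.
Qed.

Lemma deriv_leN k f e : deriv_le k f e -> deriv_le k (- f) e.
Proof.
by move=> /(deriv_leZ (-1)); rewrite scalecN1 normrN1 mul1r.
Qed.

Lemma deriv_leB k f g e d : deriv_le k f e -> deriv_le k g d ->
  deriv_le k (f - g) (e + d).
Proof. by move=> fe gd; apply: deriv_leD => //; exact: deriv_leN. Qed.

Lemma deriv_le_i k f e : deriv_le k f e -> deriv_le k ('i%C *: f) e.
Proof.
move=> fe b z s zL sk y zy.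
have -> : partial s (local_rep b z ('i%C *: f)) y =
    (-1) ^+ b * partial s (local_rep (~~ b) z f) y.
  have := @partial_lin (region z) (local_rep (~~ b) z f) (fun=> 0)
    (local_rep b z ('i%C *: f)) ((-1) ^+ b) s (@region_open z) _ _ _ y zy.
  rewrite partial_zero addr0.
  apply.
  - by move=> t w zw; apply: local_rep_smooth; exact: region_image.
  - exact: smooth_on_cst.
  move=> w _; rewrite /local_rep addr0.
  have -> : ('i%C *: f) (param (atlas (chart_at K z)) w) =
      'i%C * f (param (atlas (chart_at K z)) w) by [].
  case: (f _) b => u v [] /=;
    by rewrite ?mul0r ?mul1r ?expr1 ?expr0 ?mulN1r ?mul1r ?addr0 ?add0r ?sub0r.
by rewrite normrM normrX normrN1 expr1n mul1r; exact: fe.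
Qed.

End seminorms.

(** * Total boundedness *)

Section finite_nets.

Lemma seq_bound (R : realDomainType) (T : eqType) (l : seq T) (Q : T -> R -> Prop) :
  (forall a e d, e <= d -> Q a e -> Q a d) ->
  (forall a, a \in l -> exists e, Q a e) ->
  exists e, forall a, a \in l -> Q a e.
Proof.
move=> mono; elim: l => [|a l IH] H; first by exists 0.
have [e He] := IH (fun x xl => H x (mem_behead (s := a :: l) xl)).
have [d Hd] := H a (mem_head _ _).
exists (Num.max d e) => x; rewrite inE => /predU1P[->|xl].
  by apply: mono Hd; rewrite le_max lexx.
by apply: mono (He x xl); rewrite le_max lexx orbT.
Qed.

(** Treating one point after the other, the functions are sorted by the integer
    part of their value there divided by e, and one function is kept in each
    nonempty class. *)
Lemma finite_value_net (R : realType) (X : eqType) (P : eqType) (v : X -> P -> R)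
    (e : R) (l : seq P) : 0 < e -> forall S : set X,
  (forall x p, S x -> p \in l -> `|v x p| <= 1) ->
  exists2 F : seq X, (forall h, h \in F -> S h) &
    forall x, S x -> exists2 h, h \in F & forall p, p \in l -> `|v x p - v h p| <= e.
Proof.
move=> e0; elim: l => [|p l IH] S Sb.
  have [[x0 Sx0]|/forallNP S0] := pselect (exists x, S x); last first.
    by exists [::] => // x /S0.
  by exists [:: x0] => [h|x _]; [rewrite inE => /eqP->|exists x0; rewrite ?inE].
pose idx x := Num.truncn ((v x p + 1) / e).
have idxge x : S x -> 0 <= (v x p + 1) / e.
  move=> Sx; apply: divr_ge0; last exact: ltW.
  by have := Sb x p Sx (mem_head _ _); rewrite ler_norml => /andP[]; lra.
pose m := (Num.truncn (2 / e)).+1.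
have idxlt x : S x -> (idx x < m)%N.
  move=> Sx; rewrite /m ltnS; apply: le_truncn; rewrite ler_pM2r ?invr_gt0//.
  by have := Sb x p Sx (mem_head _ _); rewrite ler_norml => /andP[]; lra.
have /choice[F HF] (i : nat) : exists F : seq X,
    (forall h, h \in F -> S h /\ idx h = i) /\
    forall x, S x -> idx x = i ->
      exists2 h, h \in F & forall q, q \in l -> `|v x q - v h q| <= e.
  have [|F FS HF] := IH [set x | S x /\ idx x = i].
    by move=> x q [Sx _] ql; apply: Sb => //; rewrite inE ql orbT.
  by exists F; split=> // x Sx xi; exact: HF.
exists (flatten [seq F i | i <- iota 0 m]).
  by move=> h /flatten_mapP[i _ /(HF i).1[]].
move=> x Sx; have [h hF hl] := (HF (idx x)).2 x Sx erefl.
have [Sh hx] := (HF (idx x)).1 h hF.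
exists h; first by apply/flatten_mapP; exists (idx x) => //; rewrite mem_iota idxlt.
move=> q; rewrite inE => /predU1P[->|]; last exact: hl.
have := truncn_itv (idxge x Sx); have := truncn_itv (idxge h Sh).
rewrite -/(idx x) -/(idx h) hx => /andP[a1 a2] /andP[b1 b2].
have : `|(v x p + 1) / e - (v h p + 1) / e| <= 1.
  rewrite ler_norml; move: a1 a2 b1 b2; rewrite -natr1; lra.
rewrite -mulrBl normrM normfV (gtr0_norm e0) ler_pdivrMr// mul1r.
by rewrite opprD addrACA subrr addr0.
Qed.

Fixpoint words (n k : nat) : seq (seq 'I_n) :=
  if k is k'.+1 then [::] :: [seq j :: s | j <- enum 'I_n, s <- words n k']
  else [:: [::]].

Lemma mem_words n k s : (s \in words n k) = (size s <= k)%N.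
Proof.
elim: k s => [|k IH] [|j s] //=; rewrite ltnS -IH inE /=.
apply/allpairsP/idP => [[[i t] /= [_ tk [_ ->]]]//|sk].
by exists (j, s); rewrite mem_enum.
Qed.

End finite_nets.

Section compactness.
Context {R : realType} {n : nat} {M : oriented_manifold R n} (K : good_cover M).
Implicit Types (f g : Cinf M) (z : M) (s : seq 'I_n) (b : bool).

Lemma deriv_le_exists k f : exists e, deriv_le K k f e.
Proof.
pose L := [seq (zs, b) | zs <- [seq (z, s) | z <- centers K, s <- words n k],
   b <- [:: true; false]].
have [||e He] := @seq_bound R _ L (fun p e => forall y, region K p.1.1 y ->
    `|partial p.1.2 (local_rep K p.2 p.1.1 f) y| <= e).
- by move=> a e d ed H y ay; apply: le_trans (H y ay) ed.
- move=> [[z s] b] _ /=.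
  have [B [_ HB]] : bounded_set (partial s (local_rep K b z f) @` closed_region K z).
    apply: compact_bounded; apply: continuous_compact;
      last exact: closed_region_compact.
    apply: continuous_in_subspaceT => y /set_mem zy.
    by have [] := @local_rep_smooth _ _ _ K b z f s _ (closed_region_image zy).
  exists (B + 1) => y zy; apply: HB; first by rewrite ltrDl.
  by exists y => //; exact: region_closed.
exists e => b z s zL sk y zy; apply: (He (z, s, b)) => //.
apply/allpairsP; exists ((z, s), b); split=> //=; last by case: b; rewrite !inE.
by apply/allpairsP; exists (z, s); rewrite mem_words.
Qed.

(** The closed balls of the cover are compact sets of coordinates, so that
    finitely many of the seminorms defining the topology dominate the C^k-norm. *)
Lemma deriv_le_nbhs k e : 0 < e -> nbhs (0 : Cinf M) [set f | deriv_le K k f e].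
Proof.
move=> e0.
pose idx (p : M * seq 'I_n) : Cinf_index M :=
  (chart_at K p.1, closed_region K p.1, p.2).
exists (idx @` [set` [seq (z, s) | z <- centers K, s <- words n k]]), e; split => //.
- exact/finite_image/finite_seq.
- move=> _ [[z s] _ <-]; split => /=; first exact: closed_region_compact.
  exact: closed_region_image.
- move=> f /= Hf b z s zL sk y zy.
  have : (Cinf_seminorm (idx (z, s)) (f - 0)%R < e%:E)%E.
    apply: Hf; exists (z, s) => //=; apply/allpairsP; exists (z, s).
    by rewrite mem_words.
  rewrite subr0 => /ltW; apply: contraPP => /negP; rewrite -ltNge => lt.
  apply/negP; rewrite -ltNge; apply: lt_le_trans (_ : (normc
      (cpartial (chart_at K z) s f y))%:E <= _)%E; last first.
    by apply: ereal_sup_ubound; exists y => //; exact: region_closed.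
  rewrite lte_fin; apply: lt_le_trans lt _.
  rewrite (_ : partial s _ y = reim b (cpartial (chart_at K z) s f y)).
    exact: reim_le_normc.
  by case: b.
Qed.

Lemma region_net z e : 0 < e -> exists l : seq 'rV[R]_n,
  (forall w, w \in l -> region K z w) /\
  forall y, region K z y -> exists2 w, w \in l & `|y - w| < e.
Proof.
move=> e0; have := @closed_region_compact _ _ _ K z; rewrite compact_cover.
move=> /(_ _ (region K z) (fun w => ball w e)).
case=> [w _|y zy|D DU HD]; first exact: ball_open.
  have [w [zw yw]] := zy (ball y e) (nbhsx_ballx y e e0).
  by exists w => //; exact: ball_sym.
exists (finmap.enum_fset D); split=> [w wD|y zy]; first by have /set_mem := DU w wD.
have [w wD /ballE] := HD y (region_closed zy).
by rewrite distrC; exists w.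
Qed.

(** Functions of the C^1-unit ball are equi-Lipschitz in each ball of the cover,
    so that they are controlled by their values on a finite net of points. *)
Lemma deriv_le_totally_bounded e : 0 < e -> exists F : seq (Cinf M),
  forall f, deriv_le K 1 f 1 -> exists2 h, h \in F & deriv_le K 0 (f - h) e.
Proof.
(* f - h has Lipschitz constant at most 2n, so that it varies by at most e / 2
   over a distance d. *)
move=> e0; pose d := e / (4 * n.+1%:R).
have d0 : 0 < d by rewrite divr_gt0// mulr_gt0.
have /choice[net Hnet] (z : M) := region_net z d0.
have [netr netP] := all_and2 Hnet.
have [||F F1 HF] := @finite_value_net R _ _
  (fun (f : Cinf M) (p : (M * 'rV[R]_n) * bool) => local_rep K p.2 p.1.1 f p.1.2)
  (e / 2) [seq (zw, b) | zw <- [seq (z, w) | z <- centers K, w <- net z],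
             b <- [:: true; false]] _ [set f | deriv_le K 1 f 1].
- by rewrite divr_gt0.
- move=> f p f1 /allpairsP[[[z w] b] [/= + _ ->]].
  move=> /allpairsPdep[z' [w' [zL wz [-> ->]]]].
  exact: (f1 b z' [::] zL isT w' (netr z' w' wz)).
exists F => f f1; have [h hF hv] := HF f f1; exists h => //.
have h1 := F1 h hF.
move=> b z [|//] zL _ y zy /=.
have [w wz yw] := netP z y zy; have zw := netr z w wz.
have D1 := deriv_leB f1 h1.
have lip : `|local_rep K b z (f - h) y - local_rep K b z (f - h) w| <=
    n%:R * (1 + 1) * `|y - w|.
  apply: (ball_lipschitz _ _ zy zw) => [|u j zu]; first by rewrite addr_ge0.
  split; last exact: (D1 b z [:: j] zL isT u zu).
  by have [_] := @local_rep_smooth _ _ _ K b z (f - h) [::] _ (region_image zu).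
rewrite -(subrK (local_rep K b z (f - h) w) (local_rep K b z (f - h) y)).
apply: le_trans (ler_normD _ _) _; rewrite [leRHS]splitr lerD//.
  apply: le_trans lip _; apply: le_trans (_ : n%:R * (1 + 1) * d <= _).
    by rewrite ler_wpM2l// ltW.
  rewrite /d; rewrite (_ : _ * (1 + 1) * _ = e / 2 * (n%:R / n.+1%:R)); last first.
    have : n.+1%:R != 0 :> R by rewrite pnatr_eq0.
    by move: (n.+1%:R) => x x0; field.
  rewrite ler_piMr ?divr_ge0 ?(ltW e0)//.
  by rewrite ler_pdivrMr// mul1r ler_nat.
have -> : local_rep K b z (f - h) w = local_rep K b z f w - local_rep K b z h w.
  by rewrite /local_rep -reimB.
apply: (hv (z, w, b)); apply/allpairsP; exists ((z, w), b); split=> //=.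
  by apply/allpairsPdep; exists z, w.
by case: (b); rewrite !inE.
Qed.

End compactness.

(** * Completeness of the space of smooth functions *)

Section completeness.
Context {R : realType} {n : nat} {M : oriented_manifold R n} (K : good_cover M).
Implicit Types (z : M) (s : seq 'I_n) (b : bool).

Lemma real_cauchy_cvg (u : nat -> R) :
  (forall e, 0 < e -> exists N, forall i j, (N <= i)%N -> (N <= j)%N ->
     `|u i - u j| <= e) -> cvgn u.
Proof.
move=> H; apply: cauchy_cvg; apply: cauchy_exP => e e0.
have [N HN] := H (e / 2) (divr_gt0 e0 (ltr0n _ 2)); exists (u N).
exists N => // j /= Nj; rewrite /ball/=.
by apply: le_lt_trans (HN N j (leqnn N) Nj) _; rewrite ltr_pdivrMr// ltr_pMr// ltr1n.
Qed.

(** Near each point, F read in any chart is F read in a chart of the cover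
    composed with a coordinate change. *)
Lemma smooth_fun_cover (F : M -> R[i]) :
  (forall b z, z \in centers K -> smooth_on (region K z) (local_rep K b z F)) ->
  smooth_fun F.
Proof.
move=> sF i.
suff H b : smooth_on (image_coord i) (fun y => reim b (F (param (atlas i) y))).
  by split; [exact: (H true)|exact: (H false)].
move=> s y [x ix xy]; have [z zL [zx rx]] := balls_cover K x.
pose W := dom (atlas (chart_at K z)) `&` coord (atlas (chart_at K z)) @^-1` region K z.
pose V := image_coord i `&` param (atlas i) @^-1` (dom (atlas i) `&` W).
pose p y := coord (atlas (chart_at K z)) (param (atlas i) y).
have oW : open W by apply: chart_open; exact: region_open.
have oV : open V.
  rewrite openE => w [iw Ww]; apply: filterI.
    by apply: open_nbhs_nbhs; split => //; exact: image_coord_open.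
  apply: (param_continuous_at iw); apply: open_nbhs_nbhs; split => //.
  by apply: openI => //; exact: open_dom.
have Vy : V y.
  by rewrite -xy; split; [exists x|rewrite /= coordK].
have sp k : smooth_on V (fun w => p w 0 k).
  move=> t w [[x' ix' <-]]; rewrite /= coordK// => -[_ [zx' _]].
  by apply: (@atlas_smooth _ _ M i (chart_at K z) k); exists x'.
have := smooth_on_comp oV (@region_open _ _ _ K z) (f := local_rep K b z F)
  (p := p) _ sp (sF b z zL).
move=> /(_ (fun w Vw => Vw.2.2.2)) sFp.
apply: (@smooth_on_eq _ _ V (local_rep K b z F \o p)) => //.
by move=> w [_ [_ [zw _]]]; rewrite /local_rep/= /p coordK.
Qed.

(** The derivatives of all orders converge uniformly on the balls of the cover,
    and their limits are the derivatives of the limit. *)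
Lemma Cinf_complete (f : nat -> Cinf M) :
  (forall k e, 0 < e -> exists N, forall i j, (N <= i)%N -> (N <= j)%N ->
     deriv_le K k (f i - f j) e) ->
  exists g : Cinf M, forall k e, 0 < e ->
    \forall j \near \oo, deriv_le K k (f j - g) e.
Proof.
move=> Hf.
pose v b z s y j := partial s (local_rep K b z (f j)) y.
have cauchy_v b z s y : z \in centers K -> region K z y -> cvgn (v b z s y).
  move=> zL zy; apply: real_cauchy_cvg => e e0.
  have [N HN] := Hf (size s) e e0; exists N => i j Ni Nj.
  by rewrite -partial_repB//; apply: (HN i j Ni Nj).
pose h b z s y := lim (v b z s y @ \oo).
have unif k e : 0 < e -> exists N, forall j, (N <= j)%N -> forall b z s y,
    z \in centers K -> (size s <= k)%N -> region K z y ->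
    `|v b z s y j - h b z s y| <= e.
  move=> e0; have [N HN] := Hf k e e0; exists N => j Nj b z s y zL sk zy.
  have cv := cauchy_v b z s y zL zy.
  have cg : (fun i => `|v b z s y j - v b z s y i|) @ \oo -->
      `|v b z s y j - h b z s y|.
    by apply: cvg_norm; apply: cvgB => //; exact: cvg_cst.
  rewrite -(cvg_lim _ cg)//; apply: limr_le; first by apply/cvg_ex; eexists; exact: cg.
  exists N => // i /= Ni; rewrite /v -partial_repB//; exact: (HN j i Nj Ni b z s).
pose F x : R[i] := (lim ((fun j => reim true (f j x)) @ \oo) +i*
   lim ((fun j => reim false (f j x)) @ \oo))%C.
have hE b z y : h b z [::] y = local_rep K b z F y by case: b.
have dh b z s i y : z \in centers K -> region K z y ->
    is_derive y 'e_i (h b z s) (h b z (i :: s) y).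
  move=> zL; move: y; apply: (@is_derive_uniform_limit _ _ _
    (fun j => partial s (local_rep K b z (f j)))).
  - exact: region_open.
  - move=> j w zw.
    by have [] := @local_rep_smooth _ _ _ K b z (f j) s _ (region_image zw).
  - by move=> w zw; exact: cauchy_v.
  - move=> e e0; have [N HN] := unif (size s).+1 e e0.
    by exists N => // j /= Nj w zw; exact: (HN j Nj b z (i :: s) w).
have ch b z s y : z \in centers K -> region K z y -> {for y, continuous (h b z s)}.
  move=> zL zy; apply/(@cvgrPdist_le _ _ _ (nbhs y) (nbhs_filter y)) => e e0.
  have e3 : 0 < e / 3 by rewrite divr_gt0.
  have [N HN] := unif (size s) _ e3; have {}HN := HN N (leqnn N) b z s.
  have [cN _] := @local_rep_smooth _ _ _ K b z (f N) s _ (region_image zy).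
  move/cvgrPdist_le : cN => /(_ _ e3) cN.
  have zn : nbhs y (region K z).
    by apply: open_nbhs_nbhs; split => //; exact: region_open.
  near=> w; have zw : region K z w by near: w.
  have H1 := HN y zL (leqnn _) zy; have H2 := HN w zL (leqnn _) zw.
  have H3 : `|v b z s y N - v b z s w N| <= e / 3 by near: w.
  move: H1 H2 H3; rewrite !ler_norml => /andP[? ?] /andP[? ?] /andP[? ?].
  by apply/andP; split; lra.
have pF b z s y : z \in centers K -> region K z y ->
    partial s (local_rep K b z F) y = h b z s y.
  move=> zL; elim: s y => [|i s IH] y zy; first by rewrite hE.
  have [_ <- /=] := dh b z s i y zL zy.
  apply: near_eq_derive; near=> w; apply: IH; near: w.
  by apply: open_nbhs_nbhs; split => //; exact: region_open.
have sF : smooth_fun F.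
  apply: smooth_fun_cover => b z zL s y zy.
  have nE := near_open (@region_open _ _ _ K z)
    (fun y zy => esym (pF b z s y zL zy)) zy.
  split=> [|j].
    rewrite /prop_for /continuous_at -(nbhs_singleton nE).
    apply: cvg_trans (near_eq_cvg nE) _; exact: ch.
  by apply: near_eq_derivable nE _; have [] := dh b z s j y zL zy.
pose g : Cinf M := MkCinf (introT (asboolP _) sF).
exists g => k e e0.
have [N HN] := unif k e e0; exists N => // j /= Nj b z s zL sk y zy.
rewrite (partial_repB b s (f j) g zy) (pF b z s y zL zy); exact: HN.
Unshelve. all: by end_near. Qed.

End completeness.

(** * Finiteness of the volume and integration of smooth functions *)

Section boxes.
Context {R : realType}.

Definition box (n : nat) (N : R) : set (n.-tuple (measurableTypeR R)) :=
  [set t | forall j, tnth t j \in `[- N, N]].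
Arguments box : clear implicits.

Lemma measurable_box n N : measurable (box n N).
Proof.
rewrite (_ : box n N = \bigcap_(j in [set: 'I_n]) (fun t => tnth t j) @^-1` `[- N, N]).
  apply: fin_bigcap_measurable; first exact: finite_finset.
  by move=> j _; rewrite -[X in measurable X]setTI; exact: measurable_tnth.
by apply/seteqP; split=> [t H j _|t H j]; [exact: H|exact: (H j I)].
Qed.

Lemma lebesgue_box_lty n N : (lebesgue_tuple n (box n N) < +oo)%E.
Proof.
elim: n => [|n IH] /=; first by rewrite diracE ltry.
rewrite /cons_measure /pushforward.
rewrite (_ : _ @^-1` _ = `[- N, N]%classic `*` box n N); last first.
  apply/seteqP; split=> [[x t] /= H|[x t] /= [Hx Ht] j].
    split; first by have := H ord0; rewrite tnth0.
    by move=> j; have := H (lift ord0 j); rewrite tnthS.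
  by case: (unliftP ord0 j) => [i ->|->]; rewrite ?tnthS ?tnth0//; exact: Ht.
rewrite product_measure1E//; last exact: measurable_box.
apply: lte_mul_pinfty => //.
  rewrite ge0_fin_numE//.
  rewrite -[X in (X < _)%E]/(lebesgue_measure (`[- N, N]%classic : set R)).
  by rewrite lebesgue_measure_itv/=; case: ifP => _; rewrite ?ltry.
Qed.

End boxes.
Arguments box : clear implicits.

Section unmeasured.
Local Open Scope ereal_scope.
Context d (T : measurableType d) {R : realType} (mu : {measure set T -> \bar R}).

(** The integral of a nonnegative function being a supremum over simple
    functions, it is monotone without any measurability of the smaller
    function or of its domain. *)
Lemma integral_le_cst (D A : set T) (f : T -> \bar R) (B : R) : measurable A ->
  D `<=` A -> (0 <= B)%R -> (forall x, D x -> 0 <= f x <= B%:E) ->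
  \int[mu]_(x in D) f x <= B%:E * mu A.
Proof.
move=> mA DA B0 fB; rewrite -integral_cst// !ge0_integralE => //; last first.
  by move=> x Dx; have /andP[] := fB x Dx.
apply: ereal_sup_le => _ [h /= hf <-]; exists h => // x.
apply: le_trans (hf x) _; rewrite /patch; case: ifPn => [/set_mem Dx|_].
  by rewrite (mem_set (DA x Dx)) /=; have /andP[] := fB x Dx.
by case: ifPn => _ //; rewrite lee_fin.
Qed.

End unmeasured.

Section volume.
Context {R : realType} {n : nat} {M : oriented_manifold R n} (K : good_cover M).
Context {g : riemannian_metric M} {vol : {measure set (borel M) -> \bar R}}.
Context (vol_g : is_riemannian_volume g vol).
Implicit Types (f phi : Cinf M) (u v : distr M) (z x : M) (b : bool).

Lemma open_borel (A : set (borel M)) : open (A : set M) -> measurable A.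
Proof. by move=> oA; exact: sub_sigma_algebra. Qed.

Lemma cover_lty (T : eqType) (l : seq T) (A : T -> set (borel M)) :
  (forall z : T, z \in l -> measurable (A z) /\ (vol (A z) < +oo)%E) ->
  measurable (\bigcup_(z in [set` l]) A z) /\
  (vol (\bigcup_(z in [set` l]) A z) < +oo)%E.
Proof.
elim: l => [|z l IH] H.
  rewrite (_ : \bigcup_(_ in _) _ = set0) ?measure0; first by split; [|exact: ltry].
  by apply/seteqP; split => // x [].
have [mz oz] := H z (mem_head _ _).
have [ml ol] := IH (fun t tl => H t (mem_behead (s := z :: l) tl)).
have -> : \bigcup_(y in [set` z :: l]) A y = A z `|` \bigcup_(y in [set` l]) A y.
  rewrite -bigcup_setU1; congr bigcup; apply/seteqP; split=> t /=.
    by rewrite inE => /predU1P[->|tl]; [left|right].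
  by rewrite inE => -[->|tl]; apply/predU1P; [left|right].
split; first exact: measurableU.
by apply: le_lt_trans (measureU2 _ mz ml) _; exact: lte_add_pinfty.
Qed.

Lemma det_bounded z : exists2 B, 0 <= B & forall y, region K z y ->
  Num.sqrt (\det (gram g (chart_at K z) y)) <= B.
Proof.
have [B [_ HB]] : bounded_set
    ((fun y => Num.sqrt (\det (gram g (chart_at K z) y))) @` closed_region K z).
  apply: compact_bounded; apply: continuous_compact;
    last exact: closed_region_compact.
  apply: continuous_in_subspaceT => y /set_mem zy.
  apply: continuous_comp; last exact: sqrt_continuous.
  rewrite /determinant.
  apply: (@cvg_big _ _ +%R 0 _ _ _ (nbhs y) _ _ _ (nbhs_filter y)) => [|s _].
    exact: add_continuous.
  have cp : (fun w => \prod_i gram g (chart_at K z) w i (s i)) @ y -->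
      \prod_i gram g (chart_at K z) y i (s i).
    have H := @cvg_big R 'I_n *%R 1 xpredT (@mul_continuous R) _ (nbhs y)
      (index_enum _) (fun i w => gram g (chart_at K z) w i (s i))
      (fun i => gram g (chart_at K z) y i (s i)) (nbhs_filter y).
    apply: H => i _.
    by have [] := @gram_smooth _ _ _ g (chart_at K z) i (s i) [::] y
      (closed_region_image zy).
  exact: (cvgM (cvg_cst _) cp).
exists (`|B| + 1) => [|y zy]; first by rewrite addr_ge0.
apply: le_trans (ler_norm _) _; apply: HB; last by exists y => //; exact: region_closed.
by rewrite (le_lt_trans (ler_norm B))// ltrDl.
Qed.

Lemma region_box z : exists N, forall y, region K z y ->
  box R n N [tuple y 0 j | j < n].
Proof.
have [B [_ HB]] := compact_bounded (@closed_region_compact _ _ _ K z).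
exists (B + 1) => y zy j; rewrite tnth_mktuple in_itv/= -ler_norml.
apply: le_trans (mx_entry_le y j) _; apply: HB; first by rewrite ltrDl.
exact: region_closed.
Qed.

(** Each ball of the cover is a bounded set of coordinates, on which the
    Riemannian density is bounded. *)
Lemma vol_lty : (vol [set: borel M] < +oo)%E.
Proof.
pose A z : set (borel M) := dom (atlas (chart_at K z)) `&`
  coord (atlas (chart_at K z)) @^-1` region K z.
have -> : [set: borel M] = \bigcup_(z in [set` centers K]) A z.
  apply/seteqP; split=> // x _; have [z zL [zx rx]] := balls_cover K x.
  by exists z.
apply: (cover_lty _).2 => z _.
have mA : measurable (A z) by apply: open_borel; apply: chart_open; exact: region_open.
split => //; rewrite (@vol_g (chart_at K z) _ mA); last by move=> x [].
have [B B0 HB] := det_bounded z; have [N HN] := region_box z.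
apply: le_lt_trans (_ : (B%:E * lebesgue_tuple n (box R n N))%E < +oo%E)%E; last first.
  by apply: lte_mul_pinfty => //; exact: lebesgue_box_lty.
have E (t : n.-tuple R) x : A z x ->
    coord (atlas (chart_at K z)) x = \row_j tnth t j ->
    region K z (\row_j tnth t j).
  by move=> [_ rx] <-.
apply: integral_le_cst => //.
- exact: measurable_box.
- move=> t [x Ax xt]; have := HN _ (E t x Ax xt).
  by congr box; apply: eq_from_tnth => j; rewrite tnth_mktuple mxE.
- move=> t [x Ax xt]; rewrite !lee_fin sqrtr_ge0 HB//; exact: E Ax xt.
Qed.

Lemma Cinf_continuous f b : continuous (fun x : M => reim b (f x)).
Proof.
move=> x; have [i ix] := atlas_cover x.
have H : {near x, (fun x => reim b (f (param (atlas i) (coord (atlas i) x)))) =1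
    (fun x => reim b (f x))}.
  near=> w; rewrite coordK//; near: w.
  by apply: open_nbhs_nbhs; split => //; exact: open_dom.
rewrite /continuous_at -(nbhs_singleton H).
apply: cvg_trans (near_eq_cvg H) _.
apply: (@continuous_comp _ _ _ (coord (atlas i))
  (fun y => reim b (f (param (atlas i) y)))).
  exact: coord_continuous_at.
by have [] := @Cinf_smooth _ _ _ f i b [::] (coord (atlas i) x)
  (ex_intro2 _ _ x ix erefl).
Unshelve. all: by end_near. Qed.

Lemma continuous_borel (h : M -> R) : continuous h ->
  measurable_fun [set: borel M] (h : borel M -> R).
Proof.
move=> /continuousP ch.
apply: (measurability _ (measurable_realfun.RGenOpens.measurableE R)).
move=> _ [_ [a [b ->] <-]]; rewrite setTI; apply: open_borel.
exact/ch/interval_open.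
Qed.

Lemma reimM b (w w' : R[i]) : reim b (w * w') = if b
  then reim true w * reim true w' - reim false w * reim false w'
  else reim true w * reim false w' + reim false w * reim true w'.
Proof. by case: b w w' => [] [? ?] [? ?]. Qed.

Lemma reimM_le b (w w' : R[i]) e d : (forall b, `|reim b w| <= e) ->
  (forall b, `|reim b w'| <= d) -> `|reim b (w * w')| <= 2 * e * d.
Proof.
move=> we wd; have H b1 b2 : `|reim b1 w * reim b2 w'| <= e * d.
  by rewrite normrM ler_pM.
rewrite reimM (_ : 2 * e * d = e * d + e * d); last by ring.
case: b; [apply: le_trans (ler_normB _ _) _|apply: le_trans (ler_normD _ _) _];
  by rewrite lerD.
Qed.

Lemma integrable_reimM f phi b : vol.-integrable [set: borel M]
  (EFin \o (fun x => reim b (f x * phi x))).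
Proof.
apply: measurable_bounded_integrable => //; first exact: vol_lty.
  apply: continuous_borel => x.
  have c h b' := @Cinf_continuous h b' x.
  rewrite (_ : (fun x => _) = (fun x => if b
    then reim true (f x) * reim true (phi x) - reim false (f x) * reim false (phi x)
    else reim true (f x) * reim false (phi x) + reim false (f x) * reim true (phi x)));
    last by apply/funext => w; rewrite reimM.
  by case: b; [apply: cvgB|apply: cvgD]; apply: cvgM; exact: c.
have [e /deriv_le0P fe] := deriv_le_exists K 0 f.
have [d /deriv_le0P pd] := deriv_le_exists K 0 phi.
exists (2 * e * d); split; first exact: num_real.
by move=> B HB x _ /=; apply: le_trans (ltW HB); exact: reimM_le.
Qed.

Lemma reim_cintegral b (h : M -> R[i]) :
  reim b (cintegral vol h) = (\int[vol]_(x in [set: borel M]) reim b (h x))%R.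
Proof. by case: b. Qed.

Lemma cintegral_le f phi e d :
  deriv_le K 0 f e -> deriv_le K 0 phi d ->
  normc (cintegral vol (fun x => f x * phi x)) <=
  4 * fine (vol [set: borel M]) * e * d.
Proof.
move=> /deriv_le0P fe /deriv_le0P pd.
rewrite (_ : _ * _ = 2 * (2 * e * d * fine (vol [set: borel M]))); last by ring.
apply: normc_le_reim => b; rewrite reim_cintegral.
have int := integrable_reimM f phi b.
apply: le_trans (le_normr_Rintegral _ int) _ => //.
rewrite -Rintegral_cst//; apply: le_Rintegral => //.
- by have := integrable_norm int.
- apply: measurable_bounded_integrable => //; first exact: vol_lty.
  by exists `|2 * e * d|; split; [exact: num_real|move=> B /ltW HB x _].
- by move=> x _; exact: reimM_le.
Qed.

Lemma cintegral_lin (a : R[i]) f h phi :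
  cintegral vol (fun x => (a *: f + h) x * phi x) =
  a * cintegral vol (fun x => f x * phi x) + cintegral vol (fun x => h x * phi x).
Proof.
have intD (p q : R) (F G H : M -> R) :
    vol.-integrable [set: borel M] (EFin \o F) ->
    vol.-integrable [set: borel M] (EFin \o G) ->
    vol.-integrable [set: borel M] (EFin \o H) ->
    (\int[vol]_(x in [set: borel M]) (p * F x + (q * G x + H x)) =
    p * \int[vol]_(x in [set: borel M]) F x +
    (q * \int[vol]_(x in [set: borel M]) G x + \int[vol]_(x in [set: borel M]) H x))%R.
  have Z r (F' : M -> R) : vol.-integrable [set: borel M] (EFin \o F') ->
    vol.-integrable [set: borel M] (EFin \o (fun x => r * F' x)).
    by move=> F'i; apply: eq_integrable (integrableZl _ r F'i).
  move=> Fi Gi Hi; rewrite RintegralD//; last 2 first.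
  - exact: Z.
  - by have := integrableD measurableT (Z q G Gi) Hi.
  by rewrite RintegralD//; [rewrite !RintegralZl|exact: Z].
have fi := integrable_reimM f phi; have hi := integrable_reimM h phi.
apply: reimP => b; apply/esym; rewrite [RHS]reim_cintegral.
have E x : (a *: f + h) x * phi x = a * (f x * phi x) + h x * phi x.
  by rewrite [(a *: f + h) x]/(a * f x + h x) mulrDl mulrA.
case: b.
- rewrite [LHS]Re_scaleD.
  apply: etrans (esym (intD _ _ _ _ _ (fi true) (fi false) (hi true))) _.
  by apply: eq_Rintegral => x _; rewrite E [RHS]Re_scaleD.
- rewrite [LHS]Im_scaleD.
  apply: etrans (esym (intD _ _ _ _ _ (fi false) (fi true) (hi false))) _.
  by apply: eq_Rintegral => x _; rewrite E [RHS]Im_scaleD.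
Qed.

Lemma is_function_lin (a : R[i]) u v f h : is_function vol u f ->
  is_function vol v h -> is_function vol (a *: u + v) (a *: f + h).
Proof. by move=> uf vh phi; rewrite cintegral_lin -uf -vh. Qed.

End volume.

(** * Distributions bounded for a C^k-norm *)

Section dual.
Context {R : realType} {n : nat} {M : oriented_manifold R n} (K : good_cover M).
Implicit Types (f h phi : Cinf M) (u v w : distr M) (z : M) (b : bool).

(** The dual norm of the C^k-norm, as a relation between u and its bounds. *)
Definition dual_le (k : nat) (u : Cinf M -> R[i]) (C : R) :=
  forall f e, deriv_le K k f e -> normc (u f) <= C * e.

Lemma distr_lin u (a : R[i]) f h : u (a *: f + h) = a * u f + u h.
Proof. by have /asboolP[lu _] := valP u; exact: lu. Qed.

Lemma distrB u f h : u (f - h) = u f - u h.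
Proof. by rewrite [f - h]addrC -(scaleN1r h) distr_lin mulN1r addrC. Qed.

Lemma distrZ u (a : R[i]) f : u (a *: f) = a * u f.
Proof.
have u0 : u 0 = 0 by rewrite -(subrr 0) distrB subrr.
by have := distr_lin u a f 0; rewrite !addr0 u0 addr0.
Qed.

Lemma distr_subE u v f : (u - v) f = u f - v f.
Proof. by []. Qed.

Lemma distr_scaleE (a : R[i]) u f : (a *: u) f = a * u f.
Proof. by []. Qed.

Lemma normc_triangle (x y : R[i]) : normc (x - y) <= normc x + normc y.
Proof. by apply: le_trans (le_normcD _ _) _; rewrite normcN. Qed.

Lemma normc_small_eq0 (x : R[i]) c : 0 <= c ->
  (forall e, 0 < e -> normc x <= c * e) -> x = 0.
Proof.
move=> c0 H; apply: eq0_normc; apply/eqP; rewrite eq_le normc_ge0 andbT.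
apply/ler_addgt0Pr => e e0; rewrite add0r.
apply: le_trans (H (e / (c + 1)) _) _; first by rewrite divr_gt0// ltr_wpDl.
by rewrite mulrCA ler_piMr ?(ltW e0)// ler_pdivrMr ?ltr_wpDl// mul1r lerDl.
Qed.

Lemma dual_leW k l u C D : (k <= l)%N -> C <= D -> dual_le k u C -> dual_le l u D.
Proof.
move=> kl CD uC f e fe; apply: le_trans (_ : C * e <= _).
  by apply: uC; exact: deriv_leW kl (lexx e) fe.
by rewrite ler_wpM2r// (deriv_le_ge0 fe).
Qed.

Lemma dual_leB k u v C D : dual_le k u C -> dual_le k v D -> dual_le k (u - v) (C + D).
Proof.
move=> uC vD f e fe; rewrite distr_subE mulrDl.
by apply: le_trans (normc_triangle _ _) _; rewrite lerD ?uC ?vD.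
Qed.

Lemma dual_leN k u C : dual_le k u C -> dual_le k (- u) C.
Proof. by move=> uC f e fe; rewrite [(- u) f]/(- (u f)) normcN; exact: uC. Qed.

Lemma dual_leD k u v C D : dual_le k u C -> dual_le k v D -> dual_le k (u + v) (C + D).
Proof. by move=> uC vD; rewrite -[v]opprK; apply: dual_leB => //; exact: dual_leN. Qed.

Lemma dual_leZ k (a : R) u C : dual_le k u C -> dual_le k (a%:C%C *: u) (`|a| * C).
Proof.
by move=> uC f e fe; rewrite distr_scaleE normcZ -mulrA ler_wpM2l//; exact: uC.
Qed.

Lemma dual_le0 k : dual_le k (0 : distr M) 0.
Proof. by move=> f e fe; rewrite mul0r [(0 : distr M) f]/(0 : R[i]) normc0. Qed.

Lemma dual_le_unit k u C : 0 <= C ->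
  (forall f, deriv_le K k f 1 -> normc (u f) <= C) -> dual_le k u C.
Proof.
move=> C0 H f e fe; have e0 := deriv_le_ge0 fe.
(* Rescaling f to norm 1 is possible with d > e only, since e may be 0. *)
have H' d : e < d -> normc (u f) <= C * d.
  move=> ed; have d0 : 0 < d by apply: le_lt_trans ed.
  have := H (d^-1%:C%C *: f) _; rewrite distrZ normcZ gtr0_norm ?invr_gt0//.
  rewrite mulrC ler_pdivrMr//; apply.
  apply: deriv_leW (leqnn k) _ (deriv_leZ d^-1 fe).
  by rewrite gtr0_norm ?invr_gt0// mulrC ler_pdivrMr// mul1r ltW.
apply/ler_addgt0Pr => t t0.
apply: le_trans (H' (e + t / (C + 1)) _) _.
  by rewrite ltrDl divr_gt0// ltr_wpDl.
rewrite mulrDr lerD2l mulrCA ler_piMr ?(ltW t0)//.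
by rewrite ler_pdivrMr ?ltr_wpDl// mul1r lerDl.
Qed.

Lemma deriv_le_nbhs_at k f e : 0 < e ->
  nbhs f [set h : Cinf M | deriv_le K k (h - f) e].
Proof.
move=> e0; have [F [d [finF FD d0 Fd]]] := deriv_le_nbhs K k e0.
exists F, d; split => // h Hh; apply: Fd => i Fi /=.
by rewrite subr0; exact: Hh.
Qed.

(** The C^k-norms being continuous, boundedness for one of them implies
    continuity. *)
Lemma dual_le_distr k (u : Cinf M -> R[i]) C : 0 <= C -> scalar u ->
  dual_le k u C -> exists v : distr M, forall f, v f = u f.
Proof.
move=> C0 lu uC.
suff cu : continuous u.
  by exists (MkDistr (introT (asboolP _) (conj lu cu))).
move=> f A /nbhs_ballP[[e1 e2]]/=; rewrite ltcE/= => /andP[/eqP -> e0] eA.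
have d0 : 0 < e1 / (C + 1) by rewrite divr_gt0// ltr_wpDl.
apply: filterS (deriv_le_nbhs_at k f d0) => h /= hf; apply: eA.
change ((normc (u f - u h))%:C%C < e1%:C%C); rewrite ltcR.
have -> : u f - u h = - u (h - f).
  by rewrite [h - f]addrC -(scaleN1r f) lu mulN1r opprD opprK.
rewrite normcN; have := uC (h - f) _ hf => /le_lt_trans; apply.
by rewrite mulrCA gtr_pMr// ltr_pdivrMr ?ltr_wpDl// mul1r ltrDl.
Qed.

(** The limit v is taken along an ultrafilter, on which every bounded sequence of
    numbers converges. It is a cluster point of the sequence u, so that no
    subsequence has to be extracted. *)
Lemma dual_le_weak_cluster k (u : nat -> distr M) C : 0 <= C ->
  (forall j, dual_le k (u j) C) ->
  exists2 v : distr M, dual_le k v C &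
    forall (l : seq (Cinf M)) e N, 0 < e ->
      exists2 j, (N <= j)%N & forall f, f \in l -> normc (u j f - v f) <= e.
Proof.
move=> C0 uC.
have [U [UU sU]] := ultraFilterLemma (eventually_filter).
have lim_ex b f : exists x : R, (fun j => reim b (u j f)) @ U --> x.
  have [e fe] := deriv_le_exists K k f.
  have [|x [_ cx]] := @segment_compact R (- (C * e)) (C * e)
      ((fun j => reim b (u j f)) @ U) _.
    apply: (@filterE _ U) => j /=; rewrite in_itv/= -ler_norml.
    exact: le_trans (reim_le_normc _ _) (uC j f e fe).
  exists x => A xA.
  have [//|UA] := in_ultra_setVsetC ((fun j => reim b (u j f)) @^-1` A) UU.
  by have [y [nAy Ay]] := cx (~` A) A UA xA.
have /choice[v0 Hv0] f : exists x : R[i], forall b,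
    (fun j => reim b (u j f)) @ U --> reim b x.
  have [x cx] := lim_ex true f; have [y cy] := lim_ex false f.
  by exists (x +i* y)%C => -[].
have near_v0 (l : seq (Cinf M)) e N : 0 < e ->
    exists2 j, (N <= j)%N & forall f, f \in l -> normc (u j f - v0 f) <= e.
  move=> e0; have e2 : 0 < e / 2 by rewrite divr_gt0.
  have H : U [set j | forall f, f \in l -> normc (u j f - v0 f) <= e].
    elim: l => [|f l IH]; first by apply: filterE => j f.
    have Hb b : \forall j \near U, `|reim b (v0 f) - reim b (u j f)| <= e / 2.
      by have /cvgrPdist_le/(_ _ e2) := Hv0 f b.
    near=> j => h; rewrite inE => /predU1P[->|hl]; last by move: h hl; near: j.
    rewrite [e](_ : e = 2 * (e / 2)); last by field.
    by apply: normc_le_reim => b; rewrite reimB distrC; case: b; near: j.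
  have HN : U [set j | (N <= j)%N] by apply: sU; exact: nbhs_infty_ge.
  have [j [Hj Nj]] := filter_ex (filterI H HN).
  by exists j.
have lv : scalar v0.
  move=> a f h; apply/eqP; rewrite -subr_eq0; apply/eqP.
  apply: (@normc_small_eq0 _ (1 + normc a + 1)); first by rewrite !addr_ge0 ?normc_ge0.
  move=> e e0; have [j _ Hj] := near_v0 [:: a *: f + h; f; h] e 0%N e0.
  have H1 : normc (u j (a *: f + h) - v0 (a *: f + h)) <= e.
    by apply: Hj; rewrite !inE eqxx.
  have H2 : normc (u j f - v0 f) <= e by apply: Hj; rewrite !inE eqxx orbT.
  have H3 : normc (u j h - v0 h) <= e by apply: Hj; rewrite !inE eqxx !orbT.
  rewrite [X in normc X](_ : _ = (a * (u j f - v0 f) + (u j h - v0 h)) -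
    (u j (a *: f + h) - v0 (a *: f + h))); last first.
    rewrite distr_lin.
    by move: (v0 _) (v0 f) (v0 h) (u j f) (u j h) => A B D E F; ring.
  apply: le_trans (normc_triangle _ _) _.
  rewrite (_ : (1 + normc a + 1) * e = (normc a * e + e) + e); last by ring.
  rewrite lerD//; apply: le_trans (le_normcD _ _) _; rewrite lerD//.
  by rewrite normcM ler_wpM2l// normc_ge0.
have v0C : dual_le k v0 C.
  move=> f e fe; apply/ler_addgt0Pr => t t0.
  have [j _ Hj] := near_v0 [:: f] t 0%N t0.
  have := Hj f (mem_head _ _); have := uC j f e fe.
  have := normc_triangle (u j f) (u j f - v0 f).
  rewrite opprB addrCA subrr addr0; lra.
have [v vE] := dual_le_distr C0 lv v0C.
exists v => [f e fe|l e N e0]; first by rewrite vE; exact: v0C.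
have [j Nj Hj] := near_v0 l e N e0; exists j => // f fl.
by rewrite vE; exact: Hj.
Unshelve. all: by end_near. Qed.

(** Because the C^1-ball is totally bounded for the uniform norm, weak
    convergence of functionals bounded for the uniform norm is uniform on that
    ball. *)
Lemma dual_le_cluster (u : nat -> distr M) C : 0 <= C ->
  (forall j, dual_le 0 (u j) C) ->
  exists2 v : distr M, dual_le 0 v C &
    forall e N, 0 < e -> exists2 j, (N <= j)%N & dual_le 1 (u j - v) e.
Proof.
move=> C0 uC; have [v vC Hv] := dual_le_weak_cluster C0 uC.
exists v => // e N e0; pose d := e / 2 / (2 * C + 1).
have C1 : 0 < 2 * C + 1 by rewrite ltr_wpDl// mulr_ge0.
have d0 : 0 < d by rewrite !divr_gt0.
have [F HF] := deriv_le_totally_bounded K d0.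
have [j Nj Hj] := Hv F (e / 2) N (divr_gt0 e0 (ltr0n _ 2)).
exists j => //; apply: dual_le_unit; first exact: ltW.
move=> f f1; have [h hF fh] := HF f f1.
have -> : (u j - v) f = (u j - v) h + (u j - v) (f - h).
  by move: (u j - v) => w; rewrite distrB addrC subrK.
apply: le_trans (le_normcD _ _) _; rewrite [leRHS]splitr lerD//; first exact: Hj.
apply: le_trans (dual_leB (uC j) vC fh) _.
rewrite /d mulrCA ler_piMr ?divr_ge0 ?(ltW e0)//.
rewrite ler_pdivrMr// mul1r; lra.
Qed.

End dual.

(** * Baire's theorem for a sequence of seminorms *)

Section baire.
Context {R : realType} {G : zmodType} (S : set G) (q : nat -> G -> R -> Prop).
Context (qW : forall k l x e d, (l <= k)%N -> e <= d -> q k x e -> q l x d)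
  (q0 : forall k, q k 0 0) (qN : forall k x e, q k x e -> q k (- x) e)
  (qD : forall k x y e d, q k x e -> q k y d -> q k (x + y) (e + d))
  (S0 : S 0)
  (complete : forall x : nat -> G, (forall j, S (x j)) ->
    (forall k e, 0 < e -> exists N, forall i j, (N <= i)%N -> (N <= j)%N ->
       q k (x i - x j) e) ->
    exists2 y, S y & forall k e, 0 < e -> exists N, forall j, (N <= j)%N ->
       q k (x j - y) e).

(** If no A m contained a ball, balls could be nested around points outside A 0,
    A 1, and so on, and completeness would give a point outside every A m. The
    norms [q k] are relations between a vector and its bounds, as [deriv_le] and
    [dual_le] are. *)
Lemma baire_cover (A : nat -> set G) :
  (forall x, S x -> exists m, A m x) ->
  (forall m y, S y -> (forall k e, 0 < e ->
     exists x, [/\ S x, A m x & q k (y - x) e]) -> A m y) ->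
  exists m x k r, [/\ 0 < r, S x &
    forall y, S y -> q k (y - x) r -> A m y].
Proof.
move=> cover closedA; apply: contrapT => noball.
pose ok (st : G * nat * R) := S st.1.1 /\ 0 < st.2.
pose good m (st st' : G * nat * R) := [/\ ok st',
  q st.1.2 (st'.1.1 - st.1.1) (st.2 / 4),
  (st.1.2 <= st'.1.2)%N /\ (m.+1 <= st'.1.2)%N,
  st'.2 <= st.2 / 2 /\ st'.2 <= m.+1%:R^-1 &
  forall z, S z -> q st'.1.2 (st'.1.1 - z) st'.2 -> ~ A m z].
have /choice[step Hstep] (ms : nat * (G * nat * R)) :
    exists st', ok ms.2 -> good ms.1 ms.2 st'.
  case: ms => m [[x k] r] /=; have [[/= Sx r0]|nok] := pselect (ok (x, k, r)); last first.
    by exists (x, k, r) => /nok.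
  have [y [Sy yx nAy]] : exists y, [/\ S y, q k (y - x) (r / 4) & ~ A m y].
    apply: contrapT => H; apply: noball; exists m, x, k, (r / 4).
    split => //; first by rewrite divr_gt0.
    by move=> y Sy yx; apply: contrapT => nAy; apply: H; exists y.
  have [k' [r' [r'0 Hr']]] : exists k' r', 0 < r' /\
      forall z, S z -> q k' (y - z) r' -> ~ A m z.
    apply: contrapT => H; apply: nAy; apply: closedA => // k' e e0.
    apply: contrapT => H'; apply: H; exists k', e; split => // z Sz yz Az.
    by apply: H'; exists z.
  exists (y, maxn k (maxn k' m.+1), Num.min (r / 2) (Num.min r' m.+1%:R^-1)) => _.
  split=> //=.
  - by split=> //=; rewrite !lt_min divr_gt0//= r'0/= invr_gt0.
  - by rewrite !leq_max !leqnn !orbT.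
  - by rewrite !ge_min !lexx !orbT.
  - move=> z Sz yz; apply: Hr' => //; apply: qW yz.
      by rewrite !leq_max leqnn orbT.
    by rewrite !ge_min lexx orbT.
(* The k-indices tend to infinity and the radii to 0, so that the sequence is
   Cauchy, and its limit stays in every ball, outside every A m. *)
pose st := fix st m :=
  if m is m'.+1 then step (m', st m') else (0, 0%N, 1) : G * nat * R.
have ok_st m : ok (st m).
  elim: m => [|m IH]; first by split => //=; exact: ltr01.
  by have [] := Hstep (m, st m) IH.
have good_st m : good m (st m) (st m.+1) := Hstep (m, st m) (ok_st m).
pose x m := (st m).1.1; pose K m := (st m).1.2; pose r m := (st m).2.
have r0 m : 0 < r m by have [] := ok_st m.
have Km m i : (K m <= K (m + i))%N.
  elim: i => [|i IH]; rewrite ?addn0// addnS.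
  by apply: leq_trans IH _; have [_ _ []] := good_st (m + i)%N.
have tail m i : q (K m) (x (m + i)%N - x m) ((r m - r (m + i)%N) / 2).
  elim: i => [|i IH]; first by rewrite addn0 !subrr mul0r.
  have d1 : q (K (m + i)%N) (x (m + i).+1 - x (m + i)%N) (r (m + i)%N / 4).
    by have [] := good_st (m + i)%N.
  have d2 : r (m + i).+1 <= r (m + i)%N / 2 by have [_ _ _ []] := good_st (m + i)%N.
  rewrite addnS -(subrK (x (m + i)%N) (x _)) -addrA.
  have := qD (qW (Km m i) (lexx _) d1) IH; apply: qW => //; lra.
have tail' m i : (m <= i)%N -> q (K m) (x i - x m) (r m / 2).
  move=> mi; have := tail m (i - m)%N; rewrite subnKC//; apply: qW => //.
  by rewrite ler_pM2r ?invr_gt0// gerBl ltW.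
have Kge m : (m.+1 <= K m.+1)%N by have [_ _ []] := good_st m.
have rle m : r m.+1 <= m.+1%:R^-1 by have [_ _ _ []] := good_st m.
have [||y Sy Hy] := complete (x := x).
- by move=> j; have [] := ok_st j.
- move=> k e e0; pose N := (maxn k (Num.truncn e^-1)).+1.
  have rN : r N <= e.
    apply: le_trans (rle _) _; rewrite invf_ple ?posrE//; apply: ltW.
    apply: lt_le_trans (truncnS_gt _) _.
    by rewrite ler_nat ltnS leq_maxr.
  exists N => i j Ni Nj.
  rewrite -(subrKA (x N)); rewrite -[x N - x j]opprB.
  have := qD (tail' N i Ni) (qN (tail' N j Nj)).
  apply: qW; last by rewrite -splitr.
  by apply: leq_trans (Kge _); rewrite ltnW// ltnS leq_maxl.
have xy m : q (K m) (x m - y) (r m).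
  have [N HN] := Hy (K m) (r m / 2) (divr_gt0 (r0 m) (ltr0n _ 2)).
  have := qD (qN (tail' m (maxn m N) (leq_maxl _ _))) (HN _ (leq_maxr m N)).
  by rewrite opprB addrA subrK -splitr.
have [m Am] := cover y Sy.
have [_ _ _ _ H] := good_st m.
exact: (H y Sy (xy m.+1)).
Qed.

End baire.

(** * Weak continuity of strongly continuous operators *)

Section weak_continuity.
Context {R : realType} {n : nat} {M : oriented_manifold R n} (K : good_cover M).
Implicit Types (f h phi : Cinf M) (u v w : distr M) (z : M) (b : bool).

Lemma finite_set_bound (T : Type) (F : set T) (Q : T -> R -> Prop) :
  finite_set F -> (forall a e d, e <= d -> Q a e -> Q a d) ->
  (forall a, F a -> exists e, Q a e) -> exists e, forall a, F a -> Q a e.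
Proof.
move=> finF mono H.
have /choice[e He] (a : T) : exists e, F a -> Q a e.
  have [/H[e Qe]|nF] := pselect (F a); first by exists e.
  by exists 0 => /nF.
have /finite_seqP[l El] := finite_image e finF.
have [//||d Hd] := @seq_bound R R l (fun x d => x <= d).
- by move=> a x y xy ax; exact: le_trans xy.
- by move=> a _; exists a.
exists d => a Fa; apply: mono (He a Fa); apply: Hd.
by have : [set` l] (e a) by rewrite -El; exists a.
Qed.

(** The seminorms defining the topology are finite and homogeneous, so that a
    small multiple of phi lies in any given neighbourhood of 0. *)
Lemma absorbed_bounded1 phi : absorbed_bounded [set phi].
Proof.
move=> U [F [d [finF lD d0 FU]]].
have bnd (k : Cinf_index M) : F k -> exists e, forall b y, k.1.2 y ->
    `|partial k.2 (fun y => reim b (phi (param (atlas k.1.1) y))) y| <= e.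
  move=> kl; have [kc ki] := lD k kl.
  have bb b : exists e, forall y, k.1.2 y ->
      `|partial k.2 (fun y => reim b (phi (param (atlas k.1.1) y))) y| <= e.
    have [B [_ HB]] : bounded_set
        (partial k.2 (fun y => reim b (phi (param (atlas k.1.1) y))) @` k.1.2).
      apply: compact_bounded; apply: continuous_compact => //.
      apply: continuous_in_subspaceT => y /set_mem ky.
      by have [] := @Cinf_smooth _ _ _ phi k.1.1 b k.2 y (ki _ ky).
    by exists (B + 1) => y ky; apply: HB; [rewrite ltrDl|exists y].
  have [e1 H1] := bb true; have [e2 H2] := bb false.
  exists (Num.max e1 e2) => -[] y ky; rewrite le_max.
    by rewrite H1.
  by rewrite H2// orbT.
have [|e He] := finite_set_bound (Q := fun k e => forall b y, k.1.2 y ->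
    `|partial k.2 (fun y => reim b (phi (param (atlas k.1.1) y))) y| <= e) finF _ bnd.
  by move=> k e1 e2 e12 H b y ky; apply: le_trans (H b y ky) e12.
pose e' := 2 * `|e|; pose t := d / (e' + 1).
have e'0 : 0 <= e' by rewrite mulr_ge0.
have t0 : 0 < t by rewrite divr_gt0// ltr_wpDl.
exists t^-1; first by rewrite invr_gt0.
move=> _ ->; exists (t%:C%C *: phi); last first.
  by rewrite scalerA -rmorphM mulVf ?gt_eqF// scale1r.
apply: FU => k /= kl; rewrite subr0.
apply: (@le_lt_trans _ _ (t * e')%:E); last first.
  by rewrite lte_fin /t mulrAC ltr_pdivrMr ?ltr_wpDl// ltr_pM2l// ltrDl.
apply: ub_ereal_sup => _ [y ky <-]; rewrite lee_fin.
have [kc ki] := lD k kl.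
rewrite /e' mulrCA; apply: normc_le_reim => b.
have -> : reim b (cpartial k.1.1 k.2 (t%:C%C *: phi) y) =
    partial k.2 (fun y => reim b ((t%:C%C *: phi) (param (atlas k.1.1) y))) y by case: b.
have := @partial_lin R n (image_coord k.1.1)
  (fun y => reim b (phi (param (atlas k.1.1) y))) (fun=> 0)
  (fun y => reim b ((t%:C%C *: phi) (param (atlas k.1.1) y))) t k.2
  (@image_coord_open _ _ _ _) (@Cinf_smooth _ _ _ phi k.1.1 b)
  (smooth_on_cst _) _ y (ki _ ky).
rewrite partial_zero addr0 => ->; last first.
  by move=> w _; rewrite addr0 -reimZ.
rewrite normrM gtr0_norm// ler_wpM2l ?(ltW t0)//.
by apply: le_trans (He k kl b y ky) (ler_norm _).
Qed.

(** Strong continuity of P gives this form of weak continuity because the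
    strong topology on functionals is coarser than any dual C^k-norm, and
    singletons are bounded. *)
Lemma continuous_dual_le k (P : {linear distr M -> distr M}) : continuous P ->
  forall phi e, 0 < e -> exists2 d, 0 < d &
    forall w, dual_le K k w d -> normc (P w phi) <= e.
Proof.
move=> cP phi e e0.
have nA : nbhs (P 0) [set y : distr M | normc (y phi) < e].
  exists [set [set phi]], e; split => //.
  - by move=> _ ->; exact: absorbed_bounded1.
  - move=> y /(_ _ erefl); rewrite linear0 subr0 /= => H.
    rewrite -lte_fin; apply: le_lt_trans H.
    by apply: ereal_sup_ubound; exists phi.
have [F [d [finF lD d0 FP]]] := cP 0 _ nA.
have bnd B : F B -> exists r, forall w c, 0 <= c -> dual_le K k w c ->
    forall f, B f -> normc (w f) <= r * c.
  move=> Bl; have [r r0 Hr] := lD B Bl _ (deriv_le_nbhs K k ltr01).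
  exists r => w c c0 wc f Bf; have [h h1 ->] := Hr f Bf.
  rewrite distrZ normcZ gtr0_norm// ler_wpM2l ?(ltW r0)//.
  by have := wc h 1 h1; rewrite mulr1.
have [|r Hr] := finite_set_bound
    (Q := fun (B : set (Cinf M)) r => forall w c, 0 <= c ->
    dual_le K k w c -> forall f, B f -> normc (w f) <= r * c) finF _ bnd.
  move=> B r1 r2 r12 H w c c0 wc f Bf; apply: le_trans (H w c c0 wc f Bf) _.
  by rewrite ler_wpM2r.
pose c := d / (`|r| + 1) / 2; have c0 : 0 < c by rewrite !divr_gt0// ltr_wpDl.
exists c => // w wc; apply: ltW; apply: (FP w) => B /= Bl.
rewrite subr0; apply: (@le_lt_trans _ _ (r * c)%:E).
  by apply: ub_ereal_sup => _ [f Bf <-]; rewrite lee_fin; exact: Hr (ltW c0) wc _ Bf.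
rewrite lte_fin; apply: le_lt_trans (_ : `|r| * c < _).
  by rewrite ler_wpM2r ?(ltW c0)// ler_norm.
rewrite /c mulrA; apply: lt_trans (_ : d / 2 < d); last first.
  by rewrite ltr_pdivrMr// ltr_pMr// ltr1n.
rewrite ltr_pM2r ?invr_gt0// mulrCA gtr_pMr// ltr_pdivrMr ?ltr_wpDl// mul1r.
by rewrite ltrDl.
Qed.

End weak_continuity.

(** * The range of an almost globally hypoelliptic operator *)

Section closed_range.
Context {R : realType} {n : nat} {M : oriented_manifold R n} (K : good_cover M).
Context {g : riemannian_metric M} {vol : {measure set (borel M) -> \bar R}}.
Context (vol_g : is_riemannian_volume g vol).
Context (P : {linear distr M -> distr M}) (cP : continuous P).
Implicit Types (f h phi : Cinf M) (u v w : distr M).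

Lemma is_functionB u v f h : is_function vol u f -> is_function vol v h ->
  is_function vol (u - v) (f - h).
Proof.
move=> uf vh.
have -> : u - v = (-1) *: v + u by rewrite scaleN1r addrC.
have -> : f - h = (-1) *: h + f by rewrite scaleN1r addrC.
exact: (is_function_lin K vol_g (-1) vh uf).
Qed.

Lemma is_functionZ (a : R[i]) u f : is_function vol u f ->
  is_function vol (a *: u) (a *: f).
Proof.
move=> uf; have := is_function_lin K vol_g (a - 1) uf uf.
by rewrite !scalerBl !scale1r !subrK.
Qed.

Lemma is_functionD u v f h : is_function vol u f -> is_function vol v h ->
  is_function vol (u + v) (f + h).
Proof.
by move=> uf vh; have := is_function_lin K vol_g 1 uf vh; rewrite !scale1r.
Qed.

Lemma is_function0 : is_function vol (0 : distr M) (0 : Cinf M).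
Proof.
move=> phi; have := cintegral_lin K vol_g (-1) 0 0 phi.
by rewrite scaler0 addr0 mulN1r addNr => ->.
Qed.

(** P is weakly continuous for the dual C^1-norm, and integration against a fixed
    test function is continuous for the uniform norm. *)
Lemma function_limit (v : nat -> distr M) (h : nat -> Cinf M) v0 h0 :
  (forall j, is_function vol (P (v j)) (h j)) ->
  (forall e N, 0 < e -> exists2 j, (N <= j)%N & dual_le K 1 (v j - v0) e) ->
  (forall e, 0 < e -> exists N, forall j, (N <= j)%N -> deriv_le K 0 (h j - h0) e) ->
  is_function vol (P v0) h0.
Proof.
move=> vh Hv Hh phi; have [d phid] := deriv_le_exists K 0 phi.
have d0 := deriv_le_ge0 phid.
apply/eqP; rewrite -subr_eq0; apply/eqP.
pose V := 4 * fine (vol [set: borel M]).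
have V0 : 0 <= V by rewrite mulr_ge0// fine_ge0.
apply: (@normc_small_eq0 _ _ (V * d + 1)); first by rewrite addr_ge0// mulr_ge0.
move=> e e0; have [d1 d10 Hd1] := @continuous_dual_le _ _ _ K 1 P cP phi e e0.
have [N HN] := Hh e e0; have [j Nj vj] := Hv d1 N d10.
have := cintegral_lin K vol_g (-1) h0 (h j) phi; rewrite scaleN1r addrC mulN1r.
have -> : cintegral vol (fun x => h j x * phi x) = P (v j) phi by rewrite vh.
set c0 := cintegral vol (fun x => h0 x * _) => E.
rewrite (_ : P v0 phi - c0 = (- c0 + P (v j) phi) - P (v j - v0) phi); last first.
  rewrite linearB distr_subE; move: (P (v j) phi) (P v0 phi) => A B.
  by ring.
apply: le_trans (normc_triangle _ _) _; rewrite mulrDl mul1r lerD//; last exact: Hd1.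
rewrite -E; apply: le_trans (cintegral_le vol_g (HN j Nj) phid) _.
by rewrite -/V mulrAC.
Qed.

(** The sets [bounded_image C] are closed by compactness of the dual balls, and
    they exhaust the range of P: Baire's theorem applies to them. *)
Definition bounded_image (C : R) (h : Cinf M) :=
  exists2 v : distr M, dual_le K 0 v C & is_function vol (P v) h.

Lemma bounded_imageW C D h : C <= D -> bounded_image C h -> bounded_image D h.
Proof. by move=> CD [v vC vh]; exists v => //; exact: dual_leW CD vC. Qed.

Lemma bounded_imageB C D h f : bounded_image C h -> bounded_image D f ->
  bounded_image (C + D) (h - f).
Proof.
move=> [v vC vh] [w wD wf]; exists (v - w); first exact: dual_leB.
by rewrite linearB; exact: is_functionB.
Qed.

Lemma bounded_imageZ (a : R) C h :
  bounded_image C h -> bounded_image (`|a| * C) (a%:C%C *: h).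
Proof.
move=> [v vC vh]; exists (a%:C%C *: v); first exact: dual_leZ.
by rewrite linearZ; exact: is_functionZ.
Qed.

Lemma bounded_image_limit C h (h_ : nat -> Cinf M) : 0 <= C ->
  (forall j, bounded_image C (h_ j)) ->
  (forall e, 0 < e -> exists N, forall j, (N <= j)%N -> deriv_le K 0 (h_ j - h) e) ->
  bounded_image C h.
Proof.
move=> C0 H hh.
have /choice[v Hv] j : exists v : distr M,
    dual_le K 0 v C /\ is_function vol (P v) (h_ j).
  by have [v ? ?] := H j; exists v.
have [v0 v0C Hv0] := dual_le_cluster C0 (fun j => (Hv j).1).
by exists v0 => //; exact: function_limit (fun j => (Hv j).2) Hv0 hh.
Qed.

Lemma function_dual_le u f : is_function vol u f -> exists C, dual_le K 0 u C.
Proof.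
move=> uf; have [e fe] := deriv_le_exists K 0 f.
exists (4 * fine (vol [set: borel M]) * e) => phi d phid.
rewrite uf; exact: (cintegral_le vol_g fe phid).
Qed.

Context (agh : almost_globally_hypoelliptic vol P).

Lemma agh_bounded_image u h : is_function vol (P u) h ->
  exists m : nat, bounded_image m%:R h.
Proof.
move=> Puh; have [v [f vf] PvE] := agh (ex_intro _ h Puh).
have [C vC] := function_dual_le vf.
exists (Num.truncn C).+1; exists v; last by rewrite PvE.
by apply: dual_leW vC => //; apply: ltW; exact: truncnS_gt.
Qed.

(** Baire's theorem in the graph of P provides a ball, with some centre, of pairs
    whose second component is a bounded image with a fixed bound. Subtracting the
    centre moves the ball to 0 and at most doubles the bound. *)
Lemma local_bounded_image : exists k r C, [/\ 0 < r, 0 <= C &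
  forall u h, dual_le K 1 u r -> deriv_le K k h r -> is_function vol (P u) h ->
  bounded_image C h].
Proof.
pose S : set (distr M * Cinf M) :=
  [set x | is_function vol (P x.1) x.2 /\ exists C, dual_le K 1 x.1 C].
pose q k (x : distr M * Cinf M) e := dual_le K 1 x.1 e /\ deriv_le K k x.2 e.
have S0 : S 0.
  by split; [rewrite /= linear0; exact: is_function0|exists 0; exact: dual_le0].
have qW k l x e d : (l <= k)%N -> e <= d -> q k x e -> q l x d.
  move=> lk ed [x1 x2]; split; first exact: dual_leW ed x1.
  exact: deriv_leW lk ed x2.
have q0 k : q k 0 0 by split; [exact: dual_le0|exact: deriv_le0].
have qN k x e : q k x e -> q k (- x) e.
  by move=> [x1 x2]; split; [exact: dual_leN|exact: deriv_leN].
have qD k x y e d : q k x e -> q k y d -> q k (x + y) (e + d).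
  move=> [x1 x2] [y1 y2]; split; last exact: deriv_leD.
  exact: dual_leD.
have complete (x : nat -> distr M * Cinf M) : (forall j, S (x j)) ->
    (forall k e, 0 < e -> exists N, forall i j, (N <= i)%N -> (N <= j)%N ->
       q k (x i - x j) e) ->
    exists2 y, S y & forall k e, 0 < e -> exists N, forall j, (N <= j)%N ->
       q k (x j - y) e.
  move=> Sx cx.
  have [|h Hh] := @Cinf_complete _ _ _ K (fun j => (x j).2).
    move=> k e e0; have [N HN] := cx k e e0.
    by exists N => i j Ni Nj; have [] := HN i j Ni Nj.
  have [N0 HN0] := cx 0%N 1 ltr01.
  have [_ [C xC]] := Sx N0.
  have bnd j : dual_le K 1 (x (N0 + j)%N).1 (`|C| + 1).
    rewrite -[(x _).1](subKr (x N0).1); apply: dual_leB.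
      exact: dual_leW (leqnn 1) (ler_norm C) xC.
    by have [] := HN0 N0 (N0 + j)%N (leqnn _) (leq_addr _ _).
  have [v vC Hv] := dual_le_weak_cluster (addr_ge0 (normr_ge0 C) ler01) bnd.
  have xv e : 0 < e -> exists N, forall j, (N <= j)%N -> dual_le K 1 ((x j).1 - v) e.
    move=> e0; have [N HN] := cx 0%N e e0; exists N => j Nj f d fd.
    apply/ler_addgt0Pr => t t0.
    have [i Ni Hi] := Hv [:: f] t N t0.
    have [Hji _] := HN j (N0 + i)%N Nj (leq_trans Ni (leq_addl _ _)).
    have H1 : normc ((x j).1 f - (x (N0 + i)%N).1 f) <= e * d := Hji f d fd.
    have H2 : normc ((x (N0 + i)%N).1 f - v f) <= t by apply: Hi; rewrite inE.
    rewrite distr_subE (_ : (x j).1 f - v f = ((x j).1 f - (x (N0 + i)%N).1 f) +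
      ((x (N0 + i)%N).1 f - v f)); last by ring.
    by apply: le_trans (le_normcD _ _) _; rewrite lerD.
  exists (v, h).
    split=> /=; last by exists (`|C| + 1).
    apply: (@function_limit (fun j => (x j).1) (fun j => (x j).2)).
    - by move=> j; have [] := Sx j.
    - move=> e N e0; have [N1 HN1] := xv e e0; exists (maxn N N1).
        exact: leq_maxl.
      by apply: HN1; exact: leq_maxr.
    - move=> e e0; have [N _ HN] := Hh 0%N e e0; exists N => j Nj; exact: HN.
  move=> k e e0; have [N1 HN1] := xv e e0; have [N2 _ HN2] := Hh k e e0.
  exists (maxn N1 N2) => j; rewrite geq_max => /andP[j1 j2].
  by split; [exact: HN1|exact: HN2].
have [x|m y Sy Hy|m [x0 [k [r [r0 Sx0 Hr]]]]] :=
    @baire_cover R _ S q qW q0 qN qD S0 complete (fun m x => bounded_image m%:R x.2).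
- by move=> [Px _]; exact: agh_bounded_image Px.
- have /choice[h Hh] (j : nat) : exists h, bounded_image m%:R h /\
      deriv_le K 0 (h - y.2) j.+1%:R^-1.
    have j0 : 0 < j.+1%:R^-1 :> R by rewrite invr_gt0.
    have [x [_ xm [_ yx]]] := Hy 0%N _ j0; exists x.2; split => //.
    by rewrite -opprB; exact: deriv_leN.
  apply: (@bounded_image_limit _ _ h); first by [].
    by move=> j; have [] := Hh j.
  move=> e e0; exists (Num.truncn e^-1) => j Nj; have [_] := Hh j.
  apply: deriv_leW => //; rewrite invf_ple ?posrE//; apply: ltW.
  by apply: lt_le_trans (truncnS_gt _) _; rewrite ler_nat.
- exists k, r, (m%:R + m%:R); split => //.
  move=> u h ur hr Puh.
  have x0m : bounded_image m%:R x0.2.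
    have x00 : q k (x0 - x0) r by rewrite subrr; exact: qW (leqnn k) (ltW r0) (q0 k).
    exact: (Hr x0 Sx0 x00).
  have xm : bounded_image m%:R (x0.2 + h).
    have [Px0 [C xC]] := Sx0.
    have [uC hC] : q k ((x0.1 + u, x0.2 + h) - x0) r.
      by split; rewrite /= addrAC subrr add0r.
    apply: (Hr (x0.1 + u, x0.2 + h)) => //; split => /=.
      by rewrite linearD; exact: is_functionD.
    by exists (C + r); exact: dual_leD.
  have E : (x0.2 + h) - x0.2 = h :> Cinf M by rewrite addrC addKr.
  by move: (bounded_imageB xm x0m); rewrite E.
Qed.

(** Failure of the uniform estimate gives a sequence of bounded images tending to
    0, with bound 1 but not with bound 1/2. They come from functionals that
    cluster at an element v0 of the kernel of P, and subtracting v0 makes the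
    functionals small enough for the local estimate. *)
Lemma uniform_bounded_image : exists k r C, [/\ 0 < r, 0 <= C &
  forall u h, deriv_le K k h r -> is_function vol (P u) h -> bounded_image C h].
Proof.
have [k [r [C [r0 C0 HC]]]] := local_bounded_image.
apply: contrapT => noC.
have H (j : nat) : exists (v : distr M) h,
    [/\ dual_le K 0 v 1, is_function vol (P v) h,
    deriv_le K k h (r / j.+1%:R) & ~ bounded_image (1 / 2) h].
  have [u [h [hr Puh nh]]] : exists (u : distr M) h, [/\ deriv_le K k h r,
      is_function vol (P u) h & ~ bounded_image j.+2%:R h].
    apply: contrapT => nH; apply: noC; exists k, r, j.+2%:R; split => // u h hr Puh.
    by apply: contrapT => nh; apply: nH; exists u, h.
  have exm : exists m : nat, `[< bounded_image m%:R h >].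
    by have [m mh] := agh_bounded_image Puh; exists m; apply/asboolP.
  (* c.+1 is the least integer bound of h, and it is large, so that h / c.+1 has
     bound 1 but not bound 1 / 2. *)
  case: (ex_minnP exm) => -[|c] /asboolP ch cmin.
    by exfalso; apply: nh; apply: bounded_imageW ch; rewrite ler_nat.
  have jc : (j.+2 <= c)%N.
    rewrite leqNgt; apply/negP => cj; apply: nh; apply: bounded_imageW ch.
    by rewrite ler_nat.
  have nc : ~ bounded_image c%:R h.
    by move=> /asboolP/cmin; rewrite ltnn.
  pose t : R := c.+1%:R^-1; have t0 : 0 < t by rewrite invr_gt0.
  have [v v1 vh] := bounded_imageZ t ch.
  exists v, (t%:C%C *: h); split => //.
  - by apply: dual_leW v1; rewrite // gtr0_norm// mulVf.
  - apply: deriv_leW (leqnn k) _ (deriv_leZ t hr); rewrite gtr0_norm// mulrC.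
    by rewrite ler_pM2l// lef_pV2 ?posrE// ler_nat (leq_trans _ (leqW jc))// ltnW.
  - move=> /(bounded_imageZ t^-1); rewrite scalerA -rmorphM mulVf ?gt_eqF// scale1r.
    move=> b2; apply: nc; apply: bounded_imageW b2.
    rewrite gtr0_norm ?invr_gt0// /t invrK mul1r ler_pdivrMr// -natrM ler_nat.
    by rewrite muln2 -addnn -addn1 leq_add2l (leq_trans _ jc).
have /choice[v /choice[h Hvh]] := H.
have [v0 _ Hv0] := dual_le_cluster ler01 (fun j => let: And4 p _ _ _ := Hvh j in p).
(* The local estimate scaled by t has a bound t * C below 1 / 2. *)
pose t := (2 * (C + 1))^-1.
have C1 : 0 < C + 1 by rewrite ltr_wpDl.
have t0 : 0 < t by rewrite invr_gt0 mulr_gt0.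
have small e : 0 < e -> exists N, forall j, (N <= j)%N -> r / j.+1%:R <= e.
  move=> e0; exists (Num.truncn (r / e)) => j Nj.
  rewrite ler_pdivrMr// mulrC -ler_pdivrMr//; apply: ltW.
  by apply: lt_le_trans (truncnS_gt _) _; rewrite ler_nat.
have Pv0 : is_function vol (P v0) 0.
  apply: (function_limit (v := v) (h := h)) => //.
    by move=> j; have [] := Hvh j.
  move=> e e0; have [N HN] := small e e0; exists N => j Nj; rewrite subr0.
  by have [_ _ hj _] := Hvh j; apply: deriv_leW hj => //; exact: HN.
have [N HN] := small (r * t) (mulr_gt0 r0 t0).
have [j Nj vj] := Hv0 (r * t) N (mulr_gt0 r0 t0).
have [_ Pvj hj nhj] := Hvh j; apply: nhj.
have tV0 : 0 < t^-1 by rewrite invr_gt0.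
have tr : `|t^-1| * (r * t) = r.
  by rewrite (gtr0_norm tV0) mulrCA mulVf ?mulr1// gt_eqF.
have hN : deriv_le K k (h j) (r * t) by exact: deriv_leW (HN j Nj) hj.
have := dual_leZ t^-1 vj; rewrite tr => vjt.
have := deriv_leZ t^-1 hN; rewrite tr => hjt.
have Pj : is_function vol (P (t^-1%:C%C *: (v j - v0))) (t^-1%:C%C *: h j).
  by rewrite linearZ linearB -[h j]subr0; apply: is_functionZ; exact: is_functionB.
have := bounded_imageZ t (HC _ _ vjt hjt Pj).
rewrite scalerA -rmorphM mulfV ?gt_eqF// scale1r; apply: bounded_imageW.
rewrite (gtr0_norm t0) /t mulrC ler_pdivrMr ?mulr_gt0//; lra.
Qed.

Lemma function_range u h : is_function vol (P u) h -> smooth_range vol P h.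
Proof.
move=> Puh; have [v [f vf] PvE] := agh (ex_intro _ h Puh).
by exists f, v => //; rewrite PvE.
Qed.

(** If P u_j tends to h, the uniform estimate replaces u_j - u_0 by bounded
    functionals with the same images, which cluster at a solution v of
    Pv = h - P u_0. *)
Lemma range_limit h :
  (forall k e, 0 < e -> exists2 f, smooth_range vol P f & deriv_le K k (f - h) e) ->
  smooth_range vol P h.
Proof.
move=> Hh; have [k [r [C [r0 C0 HC]]]] := uniform_bounded_image.
pose d (j : nat) := Num.min (r / 2) j.+1%:R^-1.
have d0 j : 0 < d j by rewrite lt_min divr_gt0//= invr_gt0.
have /choice[f Hf] (j : nat) : exists f,
    smooth_range vol P f /\ deriv_le K k (f - h) (d j).
  by have [f ? ?] := Hh k (d j) (d0 j); exists f.
have /choice[u Hu] (j : nat) : exists u : distr M, is_function vol (P u) (f j).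
  by have [[? [u _ Puf]] _] := Hf j; exists u.
have bnd j : bounded_image C (f j - f 0).
  apply: (HC (u j - u 0)); last by rewrite linearB; exact: is_functionB.
  rewrite -(subrKA h) -[h - f 0]opprB.
  apply: deriv_leW (leqnn k) _ (deriv_leB (Hf j).2 (Hf 0).2).
  by rewrite [leRHS]splitr lerD// ge_min lexx.
have [|v _ Pv] := @bounded_image_limit C (h - f 0) (fun j => f j - f 0) C0 bnd.
  move=> e e0; exists (Num.truncn e^-1) => j Nj.
  rewrite opprB addrA subrK; apply: deriv_leW (leq0n k) _ (Hf j).2.
  rewrite ge_min; apply/orP; right; rewrite invf_ple ?posrE//; apply: ltW.
  by apply: lt_le_trans (truncnS_gt _) _; rewrite ler_nat.
apply: (@function_range (v + u 0)); rewrite linearD -[h](subrK (f 0)).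
exact: is_functionD.
Qed.

Lemma range_closed : closed (smooth_range vol P).
Proof.
move=> h ch; apply: range_limit => k e e0.
by have [f [? ?]] := ch _ (deriv_le_nbhs_at K k h e0); exists f.
Qed.

End closed_range.

(** * Hahn-Banach separation *)

Section hahn_banach.
Context {R : realType} {V : lmodType R[i]}.
Implicit Types (q : V -> R) (x y a : V).

Definition sublinear q := (forall x y, q (x + y) <= q x + q y) /\
  forall t x, 0 < t -> q (t%:C%C *: x) <= t * q x.

Lemma sublinear0 q : sublinear q -> q 0 = 0.
Proof.
move=> [qD qZ]; apply/eqP; rewrite eq_le; apply/andP; split.
  have := qZ (1 / 2) 0 (divr_gt0 ltr01 (ltr0n _ 2)); rewrite scaler0; lra.
have := qD 0 0; rewrite addr0; lra.
Qed.

Lemma sublinearN q x : sublinear q -> - q (- x) <= q x.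
Proof.
move=> sq; have := sq.1 x (- x); rewrite subrr sublinear0//; lra.
Qed.

Lemma sublinearZ q t x : sublinear q -> 0 <= t -> q (t%:C%C *: x) = t * q x.
Proof.
move=> sq; rewrite le_eqVlt => /predU1P[<-|t0].
  by rewrite scale0r mul0r sublinear0.
apply/eqP; rewrite eq_le sq.2//=.
have := sq.2 t^-1 (t%:C%C *: x); rewrite invr_gt0 => /(_ t0).
rewrite scalerA -rmorphM mulVf ?gt_eqF// scale1r => H.
by rewrite mulrC -ler_pdivlMr// mulrC.
Qed.

(** Lowering q in the direction a keeps it sublinear and makes its value at
    [- a] at most [- q a]. *)
Definition lowered q a x : R :=
  inf [set s | exists2 t, 0 <= t & s = q (x + t%:C%C *: a) - t * q a].

Lemma lowered_le q a x t : sublinear q -> 0 <= t ->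
  lowered q a x <= q (x + t%:C%C *: a) - t * q a.
Proof.
move=> sq t0; apply: ge_inf; last by exists t.
exists (- q (- x)) => _ [s s0 ->].
have := sq.1 (x + s%:C%C *: a) (- x); rewrite [x + _]addrC addrK sublinearZ//; lra.
Qed.

Lemma le_lowered q a x c :
  (forall t, 0 <= t -> c <= q (x + t%:C%C *: a) - t * q a) -> c <= lowered q a x.
Proof.
move=> H; apply: lb_le_inf => [|_ [t t0 ->]]; last exact: H.
by exists (q (x + 0%:C%C *: a) - 0 * q a); exists 0.
Qed.

Lemma lowered_sublinear q a : sublinear q -> sublinear (lowered q a).
Proof.
move=> sq; split=> [x y|t x t0].
  rewrite -lerBlDr; apply: le_lowered => s s0; rewrite lerBlDr [leRHS]addrC -lerBlDr.
  apply: le_lowered => t t0; rewrite lerBlDr.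
  apply: le_trans (lowered_le a (x + y) sq (addr_ge0 s0 t0)) _.
  have := sq.1 (x + s%:C%C *: a) (y + t%:C%C *: a).
  by rewrite addrACA -scalerDl -rmorphD; lra.
rewrite mulrC -ler_pdivrMr//; apply: le_lowered => s s0; rewrite ler_pdivrMr//.
apply: le_trans (lowered_le a _ sq (mulr_ge0 (ltW t0) s0)) _.
rewrite rmorphM -scalerA -scalerDr sublinearZ//; last exact: ltW.
by rewrite mulrC; lra.
Qed.

Lemma lowered_le_self q a x : sublinear q -> lowered q a x <= q x.
Proof.
move=> sq; apply: le_trans (lowered_le a x sq (lexx 0)) _.
by rewrite scale0r addr0 mul0r subr0.
Qed.

(** A minimal sublinear functional is linear, being invariant under lowering. *)
Lemma minimal_additive q : sublinear q ->
  (forall q', sublinear q' -> (forall x, q' x <= q x) -> q' = q) ->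
  (forall x y, q (x + y) = q x + q y) /\
  (forall t x, q (t%:C%C *: x) = t * q x).
Proof.
move=> sq qmin.
have qD x y : q (x + y) = q x + q y.
  apply/eqP; rewrite eq_le sq.1/=.
  rewrite -{1}(qmin _ (lowered_sublinear y sq) (fun x => lowered_le_self y x sq)).
  by have := lowered_le y x sq ler01; rewrite scale1r mul1r; lra.
split=> // t x; have [t0|t0] := leP 0 t; first exact: sublinearZ.
have : q ((- t)%:C%C *: x) = - t * q x by rewrite sublinearZ// oppr_ge0 ltW.
have := qD ((- t)%:C%C *: x) (t%:C%C *: x).
by rewrite -scalerDl -rmorphD addNr scale0r sublinear0//; lra.
Qed.

(** Zorn's lemma gives a minimal sublinear functional below p lowered in the
    direction a, an infimum over a chain being sublinear. The lowering forces
    its value at a. *)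
Lemma hahn_banach_real p a : sublinear p -> exists phi : V -> R,
  [/\ forall x y, phi (x + y) = phi x + phi y,
      forall t x, phi (t%:C%C *: x) = t * phi x,
      forall x, phi x <= p x & p a <= phi a].
Proof.
move=> sp; pose p' := lowered p a; have sp' := lowered_sublinear a sp.
pose T := {q : V -> R | sublinear q /\ forall x, q x <= p' x}.
pose le (q1 q2 : T) := `[< forall x, sval q2 x <= sval q1 x >].
have [|||A Atot|[q [sq qp]] qmax] := @Zorn T le.
- by move=> q; apply/asboolP.
- move=> q1 q2 q3 /asboolP H1 /asboolP H2; apply/asboolP => x.
  exact: le_trans (H2 x) (H1 x).
- move=> [q1 H1] [q2 H2] /asboolP H12 /asboolP H21; apply: eq_exist.
  by apply/funext => x; apply/eqP; rewrite eq_le H12 H21.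
- have [[q0 Aq0]|/forallNP A0] := pselect (exists q : T, A q); last first.
    by exists (exist _ p' (conj sp' (fun x => lexx _))) => q /A0.
  pose m x := inf [set sval r x | r in A].
  have lb x : lbound [set sval r x | r in A] (- p' (- x)).
    move=> _ [[q [sq qp]] _ <-] /=; apply: le_trans (sublinearN x sq).
    by rewrite lerN2.
  have m_le (q : T) x : A q -> m x <= sval q x.
    by move=> Aq; apply: ge_inf; [exists (- p' (- x))|exists q].
  have m_ge c x : (forall q : T, A q -> c <= sval q x) -> c <= m x.
    move=> H; apply: lb_le_inf; first by exists (sval q0 x), q0.
    by move=> _ [q Aq <-]; exact: H.
  have sm : sublinear m.
    split=> [x y|t x t0].
      rewrite -lerBlDr; apply: (m_ge _ _) => q1 Aq1.
      rewrite lerBlDr [leRHS]addrC -lerBlDr.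
      apply: (m_ge _ _) => q2 Aq2; rewrite lerBlDr.
      have [/asboolP H|/asboolP H] := Atot q1 q2 Aq1 Aq2.
        apply: le_trans (m_le _ _ Aq2) _; apply: le_trans ((svalP q2).1.1 x y) _.
        by rewrite addrC lerD2l.
      apply: le_trans (m_le _ _ Aq1) _; apply: le_trans ((svalP q1).1.1 x y) _.
      by rewrite addrC lerD2r.
    rewrite mulrC -ler_pdivrMr//; apply: (m_ge _ _) => q Aq; rewrite ler_pdivrMr//.
    by apply: le_trans (m_le _ _ Aq) _; rewrite mulrC; exact: (svalP q).1.2.
  have mp x : m x <= p' x.
    by apply: le_trans (m_le _ x Aq0) _; exact: (svalP q0).2.
  by exists (exist _ m (conj sm mp)) => q Aq; apply/asboolP => x /=; exact: m_le.
have [qD qZ] : (forall x y, q (x + y) = q x + q y) /\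
    (forall t x, q (t%:C%C *: x) = t * q x).
  apply: minimal_additive => // q' sq' q'q.
  have q'p x : q' x <= p' x by exact: le_trans (q'q x) (qp x).
  by have [] := qmax (exist _ q' (conj sq' q'p)) (introT (asboolP _) q'q).
exists q; split => //.
  by move=> x; apply: le_trans (qp x) (lowered_le_self a x sp).
have := qp (- a); have := lowered_le a (- a) sp ler01.
rewrite scale1r addNr (sublinear0 sp) mul1r -/p'.
by have := qZ (-1) a; rewrite scalecN1; lra.
Qed.

End hahn_banach.

Section solvability.
Context {R : realType} {n : nat} {M : oriented_manifold R n} (K : good_cover M).
Implicit Types (f h : Cinf M) (u v w : distr M).

(** The theorem of Hahn and Banach is applied to the distance to A for the
    C^k-norm, which vanishes on A and is at least e at h. *)
Lemma separation (A : set (Cinf M)) k e h : 0 < e -> A 0 ->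
  (forall (a : R[i]) f1 f2, A f1 -> A f2 -> A (a *: f1 + f2)) ->
  (forall f, A f -> ~ deriv_le K k (h - f) e) ->
  exists2 v : distr M, (forall f, A f -> v f = 0) & v h != 0.
Proof.
move=> e0 A0 Alin Ah.
have AD f1 f2 : A f1 -> A f2 -> A (f1 + f2).
  by move=> A1 A2; rewrite -[f1]scale1r; exact: Alin.
have AZ (a : R[i]) f : A f -> A (a *: f).
  by move=> Af; rewrite -[_ *: _]addr0; exact: Alin.
pose D f := [set d | exists2 f0, A f0 & deriv_le K k (f - f0) d].
pose p f := inf (D f).
have D_ge0 f d : D f d -> 0 <= d by move=> [f0 _ H]; exact: (deriv_le_ge0 H).
have p_le f d : D f d -> p f <= d.
  by move=> Dd; apply: ge_inf => //; exists 0 => ? ?; exact: (D_ge0 f).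
have le_p f c : (forall d, D f d -> c <= d) -> c <= p f.
  move=> H; apply: lb_le_inf => //.
  by have [d fd] := deriv_le_exists K k f; exists d, 0; rewrite ?subr0.
have sp : sublinear p.
  split=> [f1 f2|t f t0].
    rewrite -lerBlDr; apply: (le_p _ _) => d1 [g1 Ag1 H1].
    rewrite lerBlDr [leRHS]addrC -lerBlDr.
    apply: (le_p _ _) => d2 [g2 Ag2 H2]; rewrite lerBlDr [leRHS]addrC.
    apply: (p_le _ _); exists (g1 + g2); first exact: AD.
    by rewrite opprD addrACA; exact: deriv_leD.
  rewrite mulrC -ler_pdivrMr//; apply: le_p => d [g1 Ag1 H1]; rewrite ler_pdivrMr//.
  apply: (p_le _ _); exists (t%:C%C *: g1); first exact: AZ.
  rewrite -scalerBr mulrC -[X in X * _](gtr0_norm t0); exact: deriv_leZ.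
have [phi [phiD phiZ phip phih]] := hahn_banach_real h sp.
have phiN f : phi (- f) = - phi f by rewrite -scalecN1 phiZ mulN1r.
have phi_le f d : deriv_le K k f d -> `|phi f| <= d.
  move=> fd; rewrite ler_norml lerNl -phiN; apply/andP; split;
    apply: le_trans (phip _) _; apply: (p_le _ _); exists 0 => //; rewrite subr0 //.
  exact: deriv_leN.
have phiA f : A f -> phi f = 0.
  move=> Af; have H f' : A f' -> phi f' <= 0.
    move=> Af'; apply: le_trans (phip _) _; apply: (p_le _ _); exists f' => //.
    by rewrite subrr; exact: deriv_le0.
  have := H f Af; have := H (- f); rewrite -{1}scaleN1r phiN => /(_ (AZ _ _ Af)); lra.
(* The complex linear functional with real part phi. *)
pose u f : R[i] := (phi f +i* - phi ('i%C *: f))%C.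
have lu : scalar u.
  move=> [a b] f1 f2; rewrite /u.
  have E f : (a +i* b)%C *: f = a%:C%C *: f + b%:C%C *: ('i%C *: f).
    by rewrite scalerA -scalerDl [(a +i* b)%C]complexE [_%:C%C * 'i%C]mulrC.
  have iiN f : 'i%C *: ('i%C *: f) = - f.
    by rewrite scalerA -expr2 sqr_i scaleN1r.
  have iC (c : R) f : 'i%C *: (c%:C%C *: f) = c%:C%C *: ('i%C *: f).
    by rewrite !scalerA mulrC.
  apply/eqP; rewrite eq_complex /= E !scalerDr !iC iiN !phiD !phiZ phiN.
  by apply/andP; split; apply/eqP; ring.
have uk : dual_le K k u 2.
  move=> f d fd; apply: normc_le_reim => -[] /=; first exact: phi_le.
  by rewrite normrN; apply: phi_le; exact: deriv_le_i.
have [v vE] := dual_le_distr (ler0n _ 2) lu uk.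
exists v => [f Af|].
  by rewrite vE /u !phiA ?oppr0//; exact: AZ.
rewrite vE /u eq_complex /= negb_and; apply/orP; left; rewrite gt_eqF//.
apply: lt_le_trans phih; apply: lt_le_trans e0 _; apply: le_p => d [f0 Af0 H].
rewrite leNgt; apply/negP => de; apply: (Ah f0 Af0).
exact: deriv_leW (leqnn k) (ltW de) H.
Qed.

End solvability.

(** * Closed range and global solvability *)

Theorem theorem3p5 (R : realType) (n : nat) (M : oriented_manifold R n)
    (g : riemannian_metric M) (vol : {measure set (borel M) -> \bar R})
    (P : {linear distr M -> distr M}) :
  compact [set: M] -> connected [set: M] -> is_riemannian_volume g vol ->
  continuous P -> preserves_smooth vol P ->
  (almost_globally_hypoelliptic vol P -> closed (smooth_range vol P)) /\
  (globally_hypoelliptic vol P -> globally_solvable vol P).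
Proof.
move=> Mc _ vol_g cP _; have [K] := good_cover_exists Mc.
split=> [agh|gh h Hh]; first exact: (@range_closed _ _ _ K g vol vol_g P cP agh).
have agh : almost_globally_hypoelliptic vol P by move=> u /gh su; exists u.
apply: contrapT => nh.
have [k [e [e0 far]]] : exists k e, 0 < e /\
    forall f, smooth_range vol P f -> ~ deriv_le K k (h - f) e.
  apply: contrapT => near_h; apply: nh.
  apply: (@range_limit _ _ _ K g vol vol_g P cP agh) => k e e0.
  apply: contrapT => no_f; apply: near_h; exists k, e; split=> // f Pf hf.
  by apply: no_f; exists f => //; rewrite -opprB; exact: deriv_leN.
have [||v vP /eqP[]] := separation e0 _ _ far.
- by exists 0, 0; rewrite ?linear0; exact: (is_function0 K vol_g).
- move=> a f1 f2 [u1 [v1 uv1 Pv1]] [u2 [v2 uv2 Pv2]].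
  exists (a *: u1 + u2), (a *: v1 + v2); first exact: (is_function_lin K vol_g _).
  by rewrite linearP; exact: (is_function_lin K vol_g _).
by apply: Hh => f1 f2 Pf12; rewrite vP//; exists f1.
Qed.
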